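(* Let $1/4\le\beta<1/3$ and let $G$ be a graph of order $n$ with minimum degree $(1-\beta)n$ (an integer). Then $$\frac{k_s(G)}{g_s(\beta)n^s}\ge\frac{k_t(G)}{g_t(\beta)n^t}$$ for all integers $2\le t<s\le 4$, where $g_2(\beta)=(1-\beta)/2$, $g_3(\beta)=(1-2\beta)^2\beta$, $g_4(\beta)=(1-2\beta)(1-3\beta)\beta^2/2$. Moreover, the following are equivalent: (i) equality holds for some $2\le t<s\le4$; (ii) equality holds for all $2\le t<s\le4$; (iii) $(n,\beta)$ is feasible and $G\in\mathcal{G}(n,\beta)$.
   Context: All graphs are finite and simple; $k_r(G)$ is the number of $r$-cliques of $G$. Here $p=\lceil\beta^{-1}\rceil-1=3$. The family $\mathcal{G}(n,\beta)$ (defined only when $n$ and $(1-\beta)n$ are positive integers not both odd) consists of all graphs $G$ on vertex set $V$, $|V|=n$, admitting a partition $V=V_0\cup V_1\cup\dots\cup V_{p-1}$ with $|V_0|=(1-(p-1)\beta)n$ and $|V_i|=\beta n$ for $1\le i\le p-1$, such that: all edges between $V_i$ and $V_j$ are present for $0\le i<j\le p-1$; $V_i$ is independent for $1\le i\le p-1$; and $G[V_0]$ is $(1-p\beta)n$-regular with minimum number of triangles among all $(1-p\beta)n$-regular graphs on $|V_0|$ vertices. The pair $(n,\beta)$ is feasible if $\mathcal{G}(n,\beta)$ is defined and $G[V_0]$ is triangle-free for $G\in\mathcal{G}(n,\beta)$. *)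

(* Defs.v *)
From HB Require Import structures.
From mathcomp Require Import all_boot all_order all_algebra.
Set Implicit Arguments. Unset Strict Implicit. Unset Printing Implicit Defensive.
Import Order.TTheory GRing.Theory Num.Theory.

Section Graphs.
Variable T : finType.
Variable e : rel T.

Definition is_clique (S : {set T}) : bool :=
  [forall x in S, forall y in S, (x != y) ==> e x y].

Definition kr_in (A : {set T}) (r : nat) : nat :=
  #|[set S : {set T} | [&& S \subset A, #|S| == r & is_clique S]]|.

Definition kr (r : nat) : nat := kr_in setT r.

Definition deg (x : T) : nat := #|[set y | e x y]|.

Definition min_degree_is (d : nat) : Prop :=
  (forall x, d <= deg x) /\ (exists x, deg x = d).

Definition deg_in (A : {set T}) (x : T) : nat := #|[set y in A | e x y]|.
End Graphs.

Definition simple_graph (T : finType) (e : rel T) : Prop :=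
  symmetric e /\ irreflexive e.

Definition regular_graph (m c : nat) (f : rel 'I_m) : Prop :=
  simple_graph f /\ forall x : 'I_m, deg f x = c.

Section Family.
Variable R : realFieldType.
Local Open Scope ring_scope.

Definition family_defined (n : nat) (beta : R) : Prop :=
  (0 < n)%N /\ exists k : nat, k%:R = (1 - beta) * n%:R /\ (0 < k)%N /\ ~~ (odd n && odd k).

(* (V0,V1,V2) is a partition witnessing G in G(n,beta), p = 3, n = #|T| *)
Definition family_partition (T : finType) (e : rel T) (beta : R)
    (V0 V1 V2 : {set T}) : Prop :=
  let n := #|T| in
  [disjoint V0 & V1] /\ [disjoint V0 & V2] /\ [disjoint V1 & V2] /\
  V0 :|: V1 :|: V2 = setT /\
  (#|V0|%:R = (1 - 2 * beta) * n%:R :> R) /\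
  (#|V1|%:R = beta * n%:R :> R) /\ (#|V2|%:R = beta * n%:R :> R) /\
  (forall x y, x \in V0 -> y \in V1 -> e x y) /\
  (forall x y, x \in V0 -> y \in V2 -> e x y) /\
  (forall x y, x \in V1 -> y \in V2 -> e x y) /\
  (forall x y, x \in V1 -> y \in V1 -> ~~ e x y) /\
  (forall x y, x \in V2 -> y \in V2 -> ~~ e x y) /\
  exists c : nat, c%:R = (1 - 3 * beta) * n%:R /\
    (forall x, x \in V0 -> deg_in e V0 x = c) /\
    (forall f : rel 'I_#|V0|, regular_graph c f ->
       (kr_in e V0 3 <= kr f 3)%N).

Definition in_family (T : finType) (e : rel T) (beta : R) : Prop :=
  family_defined #|T| beta /\
  exists V0 V1 V2 : {set T}, family_partition e beta V0 V1 V2.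

Definition feasible (n : nat) (beta : R) : Prop :=
  family_defined n beta /\
  forall (e : rel 'I_n) (V0 V1 V2 : {set 'I_n}),
    simple_graph e -> family_partition e beta V0 V1 V2 -> kr_in e V0 3 = 0%N.

Definition gfun (s : nat) (beta : R) : R :=
  match s with
  | 2 => (1 - beta) / 2
  | 3 => (1 - 2 * beta) ^+ 2 * beta
  | 4 => (1 - 2 * beta) * (1 - 3 * beta) * beta ^+ 2 / 2
  | _ => 0
  end.

Definition normk (T : finType) (e : rel T) (s : nat) (beta : R) : R :=
  (kr e s)%:R / (gfun s beta * (#|T|%:R) ^+ s).
End Family.

(* Main.v *)
Require Import Defs.
From HB Require Import structures.
From mathcomp Require Import all_boot all_order all_algebra.
From mathcomp Require Import ring lra.
Set Implicit Arguments. Unset Strict Implicit. Unset Printing Implicit Defensive.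
Import Order.TTheory GRing.Theory Num.Theory.
Local Open Scope ring_scope.

(** Normalise by [n = #|T|] and let [D] denote codegrees: in an extremal graph
    [D] is [1 - 2 beta] or [2 beta] on edges and [1 - 3 beta] or [beta] on
    triangles.  Call an edge or a triangle heavy when [D] exceeds [2 beta],
    respectively [beta], and let [D_-] be [D] truncated at that value.

    For [t = 3], [s = 4]: summing [(D_- - (1 - 3 beta)) (D_- - beta) <= 0] over
    triangles and [\sum_(T in Q) D_-(T) >= 2 - 4 beta] over the 4-cliques [Q]
    gives the inequality.  For [t = 2], [s = 3] the same argument over edges
    leaves a loss at heavy triangles.  It is paid by the triangle itself unless
    the triangle has exactly one heavy edge.  In that case the remaining deficit
    is shared among the 4-cliques containing the triangle, and each 4-clique [Q]
    passes its balance, divided by [D(Q)], to the 5-cliques containing it.  The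
    balance of a 5-clique is nonnegative, by a finite check on the possible
    patterns of heavy triangles.

    Equality forces the extremal codegrees, hence a regular graph without
    5-cliques in which every 4-clique has two triangles with [D = beta]; the
    common neighbourhoods of these triangles are [V1] and [V2]. *)

(** * Estimates for the triangle deficits *)

(** Truncation is forced by the quadratic: [(D - (1 - 3 beta)) (D - beta)] has the wrong sign for
    [D > beta]. The part of [D] cut off at triangles returns with the positive coefficient
    [4 (1 - 3 beta)] when 4-cliques are compared with triangles, but with [-(4 beta - 1)/2 <= 0] in
    the balance of a triangle when triangles are compared with edges. This is the loss.

    A 4-clique cannot always absorb the deficits of its own triangles: a heavy edge makes both
    triangles on it heavy, and with exactly two heavy triangles the guaranteed gain of the 4-clique
    is 0. In a 5-clique the same edge makes three triangles heavy, and the other 4-cliques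
    compensate. Dividing by the codegree conserves totals, since a 4-clique of normalised codegree
    [D] extends to a 5-clique by a proportion [D] of the vertices.

    Codegrees of the 4-cliques in one 5-clique differ by at most [beta]. So either all five are at
    least [2 (1 - 3 beta)], and every 4-clique pays for itself, or all are at most [2 - 5 beta],
    which makes the shares small enough for the finite check. *)

Section Analytic.
Variable R : realFieldType.
Implicit Types (a x y d q l : R).

(** Here [a = 1 - 3 beta], so that [2(1-a)/3 = 2 beta], [(1-4a)/3 = 4 beta - 1],
    [(1+2a)/3 = 1 - 2 beta] and the right side is [bud]. The lemma says that for [a >= 1/10] the
    excess of the heavy edge pays the whole loss, hence [lam = 0] there. *)
Lemma nonlossy_large_a a x : 1/10 <= a -> a <= 1/4 -> 0 <= x ->
  (1+8*a)*x <= 2*a*(1+2*a) ->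
  (1-4*a)/3 * (2*(1-a)/3+x) <= ((1+2*a)/3)^+2 - a/36.
Proof.
move=> h1 h2 hx h.
have p : 0 < 1 + 8*a by lra.
rewrite -(ler_pM2l p).
have e : (1+8*a)*((1 - 4 * a) / 3 * (2 * (1 - a) / 3 + x)) <= (1-4*a)/3*((1+8*a)*(2*(1-a)/3) + 2*a*(1+2*a)).
  have : (1-4*a)/3*((1+8*a)*x) <= (1-4*a)/3*(2*a*(1+2*a)) by apply: ler_wpM2l; lra.
  by lra.
apply: (le_trans e).
nra.
Qed.

(** The same with the loss rate [4 beta - 1] lowered by [lam * (beta + x)]: what the heavy edge
    leaves unpaid is at most [lam * x * (beta + x)]. *)
Lemma share_small_a a x : 0 <= a -> a <= 1/10 -> 0 <= x ->
  (1+8*a)*x <= 2*a*(1+2*a) ->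
  ((1-4*a)/3 - (1-10*a)*(1-a)/2*((1-a)/3+x)) * (2*(1-a)/3+x) <= ((1+2*a)/3)^+2 - a/36.
Proof.
move=> h1 h2 hx h.
(* [1 - 10a/3] is the chord of the convex function [(1+2a)/(1+8a)] between [a = 0] and
   [a = 1/10]. *)
have h3 : x <= 2*a*(1-10/3*a).
  have p : 0 < 1 + 8*a by lra.
  rewrite -(ler_pM2l p); apply: (le_trans h); nra.
have lam0 : 0 <= (1-10*a)*(1-a) * x^+2 by apply: mulr_ge0; [apply: mulr_ge0; lra|exact: sqr_ge0].
have c0 : 0 <= a * (3/4 + 29*a - 31*a^+2+10*a^+3).
  apply: mulr_ge0 => //; nra.
(* A sixth of this polynomial is the coefficient of [x] in the difference of the two sides. The
   [x^2] term is nonnegative by [lam0], so if this coefficient is negative the bound [h3] is the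
   worst case. *)
have [k|k] := lerP 0 (1-28*a+63*a^+2-30*a^+3).
  have := mulr_ge0 hx k; nra.
have : 0 <= (2*a*(1-10/3*a) - x) * (28*a-1-63*a^+2+30*a^+3).
  by apply: mulr_ge0; lra.
have : 0 <= a * ((3/4 + 29*a - 31*a^+2+10*a^+3)/9 + (1-10/3*a)*(1-28*a+63*a^+2-30*a^+3)/3).
  apply: mulr_ge0 => //; nra.
lra.
Qed.

Variable beta : R.
Hypotheses (beta_ge : 1/4 <= beta) (beta_lt : beta < 1/3).

(* Rate at which a 4-clique may overdraw on each 5-clique containing it.  It has
   to dominate the deficits ([share_small_a]) and leave the room [lam_room]; the
   two constraints nearly meet as [beta] tends to [1/3]. *)
Definition lam : R :=
  if 1 - 3*beta <= 1/10 then 3*beta*(1 - 10*(1 - 3*beta))/2 else 0.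
(* Twice the weight with which the excess of a heavy edge enters the balance of
   its triangles.  The weight [(1 - 2 beta)^2] is available; the rest
   rules out heavy edges in the equality case. *)
Definition bud : R := (1 - 2*beta)^+2 - (1 - 3*beta)/36.

Lemma lam_ge0 : 0 <= lam.
Proof.
move: beta_ge beta_lt => bg bl.
rewrite /lam; case: ifP => // h; apply: mulr_ge0; last by lra.
by apply: mulr_ge0; lra.
Qed.

Lemma lam_le : lam <= 1/2.
Proof.
move: beta_ge beta_lt => bg bl.
rewrite /lam; case: ifP => h; last by lra.
have : 0 <= (1-3*beta) * (11 - 10*(1-3*beta))  by apply: mulr_ge0; lra.
by lra.
Qed.

(** The gain of a 4-clique with three heavy triangles may be as small as [4 beta - 1]; the shares
    charged to it must fit below that. *)
Lemma lam_room : 2*lam*(2 - 5*beta) <= 4*beta - 1.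
Proof.
move: beta_ge beta_lt => bg bl.
rewrite /lam; case: ifP => h; last by lra.
have : 0 <= (1-3*beta) * (2 + 45*(1-3*beta) - 50 * (1-3*beta)^+2).
  by apply: mulr_ge0; [lra | nra].
by nra.
Qed.

Lemma bud_ge0 : 0 <= bud.
Proof.
move: beta_ge beta_lt => bg bl.
by rewrite /bud; nra. Qed.

(** For a triangle with one heavy edge: [d] is the excess of that edge over [2 beta], [x] that of
    the triangle over [beta], [q] is [d] divided by the edge codegree, and [y] is twice the deficit.
    Divided by the triangle codegree [beta + x], the conclusions become those of [share_bounded]. *)
Lemma share_bounds d x q y : 0 < d -> d <= x -> q * (2*beta+d) = d ->
  y <= (1-2*beta)*d - bud*q - 2*(1-3*beta)*x ->
  y <= 2*(1-3*beta)*(1-2*beta) - (3-8*beta)*x - bud*q ->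
  0 < y ->
  [/\ x <= 2*(1-3*beta), y <= lam*x*(beta+x),
   2*x*(beta+x) + y <= 4*(1-3*beta)*(beta+x) &
   y <= (beta+x)*(4*beta-1-2*lam*(2-5*beta))].
Proof.
move: beta_ge beta_lt => bg bl.
move=> d0 dx hq B1 B2 y0.
have x0 : 0 < x by lra.
have s0 : 0 < 2*beta + d by lra.
have q0 : 0 <= q by rewrite -(pmulr_lge0 _ s0) hq; lra.
have b0 := bud_ge0.
have bq0 := mulr_ge0 b0 q0.
have hx : (3-8*beta)*x <= 2*(1-3*beta)*(1-2*beta) by lra.
have x2a : x <= 2*(1-3*beta).
  have p : 0 < 3-8*beta by lra.
  rewrite -(ler_pM2l p); apply: (le_trans hx); nra.
(* The bounds on [y] are weakest at [d = x], where [q] becomes [Q]. *)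
have [Q hQ] : exists Q, Q * (2*beta+x) = x.
  by exists (x/(2*beta+x)); rewrite mulfVK //; lra.
have QE : (Q - q) * ((2*beta+x)*(2*beta+d)) = 2*beta*(x-d).
  have -> : (Q - q) * ((2*beta+x)*(2*beta+d)) = Q*(2*beta+x)*(2*beta+d) - q * (2*beta+d)*(2*beta+x) by ring.
  by rewrite hQ hq; ring.
have Qq : (Q - q)*(2*beta) <= x - d.
  have pp : 0 < (2*beta+x)*(2*beta+d) by apply: mulr_gt0; lra.
  rewrite -(ler_pM2r pp).
  have -> : (Q - q) * (2 * beta) * ((2 * beta + x) * (2 * beta + d)) = 2*beta*(2*beta*(x-d)) by rewrite -QE; ring.
  have : 0 <= (x-d) * ((2 * beta + x) * (2 * beta + d) - 4*beta*beta).
    by apply: mulr_ge0; [lra|nra].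
  by lra.
(* This makes [(1-2*beta)*d - bud*d/(2*beta+d)] nondecreasing in [d >= 0]. *)
have bw : bud <= (1-2*beta)*(2*beta) by rewrite /bud; nra.
have Q_ge : 0 <= Q - q.
  have pp : 0 < (2*beta+x)*(2*beta+d) by apply: mulr_gt0; lra.
  by rewrite -(pmulr_lge0 _ pp) QE; apply: mulr_ge0; lra.
have B3 : y <= (4*beta-1)*x - bud*Q.
  have : bud*(Q-q) <= (1-2*beta)*(2*beta)*(Q-q) by apply: ler_wpM2r.
  have : (1-2*beta)*((Q-q)*(2*beta)) <= (1-2*beta)*(x-d) by apply: ler_wpM2l; lra.
  by lra.
have Q0 : 0 <= Q by lra.
have hx' : (1+8*(1-3*beta))*x <= 2*(1-3*beta)*(1+2*(1-3*beta)) by lra.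
(* Twice the first bound plus the second; then [x] is lowered to [d], as [7 - 20 beta > 0]. *)
have y_max : y <= 2/3*(1-3*beta)*(1-2*beta).
  have : 3*y <= 2*(1-2*beta)*d - 3*bud*q - (7-20*beta)*x + 2*(1-3*beta)*(1-2*beta).
    by lra.
  have : 0 <= (7-20*beta)*(x-d) by apply: mulr_ge0; lra.
  have : 0 <= q * (3*bud - (16*beta-5)*(2*beta+d)).
    apply: mulr_ge0 => //.
    by rewrite /bud; nra.
  have : q * (3*bud - (16*beta-5)*(2*beta+d)) = 3*bud*q - (16*beta-5)*d.
    by rewrite -[in RHS]hq; ring.
  by lra.
have share_le : y <= lam*x*(beta+x).
  rewrite /lam; case: ifP => h.
      have hP : ((1-4*(1-3*beta))/3 - (1-10*(1-3*beta))*(1-(1-3*beta))/2*((1-(1-3*beta))/3+x)) * (2*(1-(1-3*beta))/3+x) <= ((1+2*(1-3*beta))/3)^+2 - (1-3*beta)/36.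
        by apply: share_small_a => //; lra.
      have := ler_wpM2l Q0 hP.
      rewrite mulrCA (_ : 2 * (1 - (1 - 3 * beta)) / 3 + x = 2*beta + x); last by field.
      rewrite hQ (_ : ((1 + 2 * (1 - 3 * beta)) / 3) ^+ 2 - (1 - 3 * beta) / 36 = bud); last by rewrite /bud; field.
      by lra.
    have hP : (1-4*(1-3*beta))/3 * (2*(1-(1-3*beta))/3+x) <= ((1+2*(1-3*beta))/3)^+2 - (1-3*beta)/36.
      by apply: nonlossy_large_a => //; lra.
    have := ler_wpM2l Q0 hP.
    rewrite mulrCA (_ : 2 * (1 - (1 - 3 * beta)) / 3 + x = 2*beta + x); last by field.
    rewrite hQ (_ : ((1 + 2 * (1 - 3 * beta)) / 3) ^+ 2 - (1 - 3 * beta) / 36 = bud); last by rewrite /bud; field.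
    by lra.
split => //.
- have : 0 <= (4*beta-1)*(1-3*beta-x/2) by apply: mulr_ge0; lra.
  have : 0 <= x*(3*(1-3*beta)-x) by apply: mulr_ge0; lra.
  by lra.
- have [h|h] := boolP (1 - 3*beta <= 1/10); last first.
    by move: share_le; rewrite /lam (negbTE h) !mul0r leNgt y0.
  apply: le_trans (_ : beta * (4*beta-1-2*lam*(2-5*beta)) <= _); last first.
    by apply: ler_wpM2r; have := lam_room; lra.
  apply: (le_trans y_max); rewrite /lam h.
  have : 0 <= (1-3*beta) * (3*beta*(2 + 45*(1-3*beta) - 50 * (1-3*beta)^+2) - 6*(1-2*beta)).
    by apply: mulr_ge0; [lra | nra].
  by lra.
Qed.
End Analytic.

(** * Truncated codegrees and deficits *)

Section Shares.
Variables (R : realFieldType) (beta : R).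
Implicit Types p q r g s m : R.

Definition cut2 p : R := Num.min p (2*beta).
Definition cut3 g : R := Num.min g beta.

(* The balance of a triangle with codegree [g] and edge codegrees [p], [q], [r]. *)
Definition tnet p q r g : R :=
  (1 - 2*beta)/2 * (cut2 p + cut2 q + cut2 r - (2 - 3*beta) - cut3 g)
  + bud beta/2 * ((p - cut2 p)/p + (q - cut2 q)/q + (r - cut2 r)/r)
  - (4*beta - 1)/2 * (g - cut3 g).

(** A triangle of codegree [g] extends to a 4-clique by a proportion [g] of the vertices, so this
    splits its deficit evenly among its 4-cliques. *)
Definition share p q r g : R := Num.max 0 (- tnet p q r g) / g.

Definition triangle_data p q r g : Prop :=
  [/\ [/\ 1 - 2*beta <= p, 1 - 2*beta <= q & 1 - 2*beta <= r],
      [/\ p - beta <= g, q - beta <= g & r - beta <= g],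
      [/\ g <= p, g <= q & g <= r],
      2 - 3*beta + g <= p + q + r &
      1 - 3*beta <= g /\ g <= 1].

(** The bound by [lam] serves 4-cliques of small codegree, the next one those of codegree at least
    [2(1 - 3 beta)], and the last one those with three or four heavy triangles. *)
Definition share_bounded g s : Prop :=
  [/\ 0 <= s, (g <= beta -> s = 0), (beta < g -> 2*s <= lam beta*(g - beta)),
      (0 < s -> g - beta + s <= 2*(1 - 3*beta)) &
      2*s <= 4*beta - 1 - 2*lam beta*(2 - 5*beta)].

Hypotheses (beta_ge : 1/4 <= beta) (beta_lt : beta < 1/3).

Lemma tnetC12 p q r g : tnet p q r g = tnet q p r g.
Proof. by rewrite /tnet; ring. Qed.
Lemma tnetC23 p q r g : tnet p q r g = tnet p r q g.
Proof. by rewrite /tnet; ring. Qed.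

Lemma excess_ge0 p : 0 < p -> 0 <= (p - cut2 p)/p.
Proof.
move=> p0; apply: divr_ge0; last exact: ltW.
by rewrite subr_ge0 /cut2 ge_min lexx.
Qed.

(** Inclusion-exclusion makes the slack at least [g - cut3 g], and [(1 - 2 beta)/2 - (4 beta - 1)/2
    = 1 - 3 beta]. The explicit lower bound, rather than mere nonnegativity, is what the equality
    case uses. *)
Lemma tnet_light p q r g : triangle_data p q r g ->
  p <= 2*beta -> q <= 2*beta -> r <= 2*beta ->
  (1 - 3*beta) * (g - cut3 g) <= tnet p q r g.
Proof.
move: beta_ge beta_lt => bg bl [_ _ _ h _] hp hq hr.
rewrite /tnet /cut2 !min_l // !subrr !mul0r !addr0 mulr0 addr0.
have : (1-2*beta)/2*(2-3*beta+g) <= (1-2*beta)/2*(p+q+r) by apply: ler_wpM2l; lra.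
by lra.
Qed.

(** If the third edge is light, the slack is at least [4 beta - 1] while
    [g - beta <= beta <= 1 - 2 beta]; if it is heavy, the slack is [2(4 beta - 1)] while
    [g <= 1]. *)
Lemma tnet_two_heavy p q r g : triangle_data p q r g ->
  2*beta < p -> 2*beta < q -> 0 <= tnet p q r g.
Proof.
move: beta_ge beta_lt => bg bl [[h1 h2 h3] [h4 h5 h6] [h7 h8 h9] h [h10 h11]] hp hq.
have b0 := bud_ge0 bg bl.
have ep : 0 <= (p - cut2 p)/p by apply: excess_ge0; lra.
have eq : 0 <= (q - cut2 q)/q by apply: excess_ge0; lra.
have er : 0 <= (r - cut2 r)/r by apply: excess_ge0; lra.
have e : 0 <= bud beta/2 * ((p - cut2 p)/p + (q - cut2 q)/q + (r - cut2 r)/r).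
  by apply: mulr_ge0; [lra | apply: addr_ge0 => //; apply: addr_ge0].
suff : 0 <= (1 - 2*beta)/2 * (cut2 p + cut2 q + cut2 r - (2 - 3*beta) - cut3 g)
  - (4*beta - 1)/2 * (g - cut3 g) by rewrite /tnet; lra.
rewrite /cut2 (min_r (ltW hp)) (min_r (ltW hq)).
rewrite /cut3 (min_r (_ : beta <= g)); last by lra.
have [r1|r1] := lerP r (2*beta).
  have : (1-2*beta)/2*(4*beta-1) <= (1-2*beta)/2*(2*beta+2*beta+r-(2-3*beta)-beta).
    by apply: ler_wpM2l; lra.
  have : (4*beta-1)/2*(g-beta) <= (4*beta-1)/2*(1-2*beta) by apply: ler_wpM2l; lra.
  by lra.
have : (4*beta-1)/2*(g-beta) <= (4*beta-1)/2*(2*(1-2*beta)) by apply: ler_wpM2l; lra.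
by lra.
Qed.

Lemma share_bounded0 g : share_bounded g 0.
Proof.
move: beta_ge beta_lt => bg bl.
split=> //; rewrite ?mulr0 ?ltxx //; last by rewrite subr_ge0 lam_room.
by move=> h; rewrite mulr_ge0 ?lam_ge0 // subr_ge0 ltW.
Qed.

Lemma share0 p q r g : 0 <= tnet p q r g -> share p q r g = 0.
Proof. by move=> h; rewrite /share max_l ?mul0r // oppr_le0. Qed.

Lemma share_one_heavy p q r g : triangle_data p q r g ->
  2*beta < p -> q <= 2*beta -> r <= 2*beta -> share_bounded g (share p q r g).
Proof.
move: beta_ge beta_lt => bg bl [[h1 h2 h3] [h4 h5 h6] [h7 h8 h9] h [h10 h11]] hp hq hr.
have [k|k] := lerP 0 (tnet p q r g); first by rewrite share0 //; exact: share_bounded0.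
have g0 : 0 < g by lra.
have p0 : 0 < p by lra.
have pe : (p - 2*beta)/p * (2*beta + (p - 2*beta)) = p - 2*beta.
  by rewrite (addrC (2*beta)) subrK mulfVK // gt_eqF.
have tE : -2 * tnet p q r g = - (1-2*beta)*(q+r-2*(1-2*beta)) - bud beta*((p-2*beta)/p) + (4*beta-1)*(g-beta).
  rewrite /tnet /cut2 (min_r (ltW hp)) (min_l hq) (min_l hr) /cut3 (min_r (_ : beta <= g)); last by lra.
  by rewrite !subrr !mul0r; lra.
have [] := @share_bounds R beta bg bl (p-2*beta) (g-beta) ((p-2*beta)/p) (-2 * tnet p q r g) _ _ pe _ _ _.
- by lra.
- by lra.
- rewrite tE.
  (* Inclusion-exclusion bounds [q + r] from below here; the next bound uses [q >= g] and
     [r >= g]. *)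
  have : (1-2*beta)*(1+g-p-(1-beta)) <= (1-2*beta)*(q+r-2*(1-2*beta)) by apply: ler_wpM2l; lra.
  by lra.
- rewrite tE.
  have : (1-2*beta)*(2*g-2*(1-2*beta)) <= (1-2*beta)*(q+r-2*(1-2*beta)) by apply: ler_wpM2l; lra.
  by lra.
- by lra.
rewrite (addrC beta) subrK => x2 y1 y2 y3.
have sE : share p q r g * g = - tnet p q r g.
  by rewrite /share max_r ?mulfVK ?gt_eqF //; lra.
split.
- by rewrite /share; apply: divr_ge0; [rewrite le_max lexx | exact: ltW].
- by lra.
- by move=> _; rewrite -(ler_pM2r g0); lra.
- by move=> _; rewrite -(ler_pM2r g0); lra.
- by rewrite -(ler_pM2r g0); lra.
Qed.

Lemma triangle_dataC12 p q r g : triangle_data p q r g -> triangle_data q p r g.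
Proof. by case=> [[h1 h2 h3] [h4 h5 h6] [h7 h8 h9] ? ?]; rewrite /triangle_data (addrC q p). Qed.
Lemma triangle_dataC23 p q r g : triangle_data p q r g -> triangle_data p r q g.
Proof. by case=> [[h1 h2 h3] [h4 h5 h6] [h7 h8 h9] ? ?]; rewrite /triangle_data (addrAC p r). Qed.
Lemma shareC12 p q r g : share p q r g = share q p r g.
Proof. by rewrite /share tnetC12. Qed.
Lemma shareC23 p q r g : share p q r g = share p r q g.
Proof. by rewrite /share tnetC23. Qed.

Lemma tnet_light_ge0 p q r g : triangle_data p q r g ->
  p <= 2*beta -> q <= 2*beta -> r <= 2*beta -> 0 <= tnet p q r g.
Proof.
move: beta_ge beta_lt => bg bl t hp hq hr.
apply: le_trans (tnet_light t hp hq hr); apply: mulr_ge0; first by lra.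
by rewrite subr_ge0 /cut3 ge_min lexx.
Qed.

Lemma shareP p q r g : triangle_data p q r g -> share_bounded g (share p q r g).
Proof.
move=> t.
have tw : forall p q r, triangle_data p q r g -> 2*beta < p -> 2*beta < q ->
    share_bounded g (share p q r g).
  move=> p' q' r' t' hp hq.
  rewrite share0; [exact: share_bounded0 | exact: (tnet_two_heavy t')].
have [hp|hp] := lerP p (2*beta); have [hq|hq] := lerP q (2*beta);
  have [hr|hr] := lerP r (2*beta).
- rewrite share0; [exact: share_bounded0 | exact: (tnet_light_ge0 t)].
- rewrite shareC23 shareC12; apply: share_one_heavy => //.
  exact/triangle_dataC12/triangle_dataC23.
- by rewrite shareC12; apply: share_one_heavy => //; exact/triangle_dataC12.
- rewrite shareC12 shareC23; apply: tw => //.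
  exact/triangle_dataC23/triangle_dataC12.
- exact: share_one_heavy.
- by rewrite shareC23; apply: tw => //; exact/triangle_dataC23.
- exact: tw.
- exact: tw.
Qed.

Lemma share_heavy p q r g : triangle_data p q r g -> share p q r g != 0 ->
  [|| 2*beta < p, 2*beta < q | 2*beta < r].
Proof.
move=> t; apply: contraNT; rewrite !negb_or -!leNgt => /and3P[hp hq hr].
by rewrite share0 //; exact: (tnet_light_ge0 t).
Qed.

Definition qnet g1 g2 g3 g4 s1 s2 s3 s4 : R :=
  cut3 g1 + cut3 g2 + cut3 g3 + cut3 g4 - (2 - 4*beta) - (s1 + s2 + s3 + s4).

Definition quad_data g1 g2 g3 g4 m : Prop :=
  [/\ [/\ 1 - 3*beta <= g1, 1 - 3*beta <= g2, 1 - 3*beta <= g3 & 1 - 3*beta <= g4],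
      [/\ g1 - beta <= m, g2 - beta <= m, g3 - beta <= m & g4 - beta <= m],
      0 <= m & 2 - 4*beta + 2 * m <= g1 + g2 + g3 + g4].

(** Cutting a heavy triangle costs at most [m], so the term [2m] covers two of them. With three or
    more, the sum is at least [3 beta + (1 - 3 beta) = 1], or [4 beta], which suffices because
    [beta >= 1/4]. *)
Lemma cut3_sum_ge g1 g2 g3 g4 m : quad_data g1 g2 g3 g4 m ->
  2 - 4*beta <= cut3 g1 + cut3 g2 + cut3 g3 + cut3 g4.
Proof.
move: beta_ge beta_lt => bg bl [[? ? ? ?] [? ? ? ?] ? ?].
rewrite /cut3.
by case: (lerP g1 beta) => ?; case: (lerP g2 beta) => ?;
   case: (lerP g3 beta) => ?; case: (lerP g4 beta) => ?; lra.
Qed.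

(* One more than the guaranteed balance, in units of [lam * m], of a 4-clique with
   codegree [m] whose triangles [ti] are heavy or not; [f] tells whether some edge
   may be heavy. *)
Definition weight (t1 t2 t3 t4 f : bool) : nat :=
  match (t1 + t2 + t3 + t4)%N with
  | 0 => 5 | 1 => 3 | 2 => if f then 0 else 1 | 3 => 2 | _ => 5
  end.

(** A positive share forces [g - beta <= 2(1 - 3 beta) <= 2 - 5 beta], so shares are bounded
    independently of [g]. *)
Lemma share_linear g s m : share_bounded g s -> g - beta <= m -> 0 <= m ->
  [/\ 0 <= s, g <= beta -> s = 0, 2*s <= lam beta * m, 2*s <= lam beta*(2-5*beta) &
   2*s <= 4*beta - 1 - 2*(lam beta*(2 - 5*beta))].
Proof.
move: beta_ge beta_lt => bg bl [h1 h2 h3 h4 h5] hm m0.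
have l0 := lam_ge0 bg bl.
split => //; last by lra.
  have [h|h] := lerP g beta; first by rewrite h2 // mulr0 mulr_ge0.
  by apply: le_trans (h3 h) _; apply: ler_wpM2l.
have [h|h] := lerP g beta; first by rewrite h2 // mulr0 mulr_ge0 //; lra.
have [k|k] := lerP s 0; first by apply: (@le_trans _ _ 0); [lra|apply: mulr_ge0 => //; lra].
by apply: le_trans (h3 h) _; apply: ler_wpM2l => //; have := h4 k; lra.
Qed.

(** The gain is at least [2m >= 4L] with no heavy triangle, [m >= 2L] with one, [0] with two,
    [4 beta - 1 >= 2L] with three and twice that with four. *)
Lemma cut3_sum_ge_weight g1 g2 g3 g4 m L (f : bool) :
  quad_data g1 g2 g3 g4 m -> 0 <= L -> L <= 1/2 * m -> 2*L <= 4*beta - 1 ->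
  L * ((weight (beta < g1) (beta < g2) (beta < g3) (beta < g4) f)%:R - 1)
    <= cut3 g1 + cut3 g2 + cut3 g3 + cut3 g4 - (2 - 4*beta).
Proof.
move: beta_ge beta_lt => bg bl [[? ? ? ?] [? ? ? ?] ? ?] ? ? ?.
clear beta_ge beta_lt; rewrite /cut3 /weight.
case: (lerP g1 beta) => ?; case: (lerP g2 beta) => ?;
   case: (lerP g3 beta) => ?; case: (lerP g4 beta) => ?; rewrite /addn /=;
   try match goal with |- context [f] => case: (f) end; lra.
Qed.

Let share_lin (L M : R) g s : Prop :=
  [/\ g <= beta -> s = 0, 2*s <= L, 2*s <= M & 2*s <= 4*beta - 1 - 2 * M].

(** [L] and [M] stand for [lam beta * m] and [lam beta * (2 - 5 beta)], which keeps the case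
    analysis linear. Two shares cost at most [L]; three cost at most [4 beta - 1 - 3M/2] out of
    [4 beta - 1], and four at most [2(4 beta - 1) - 4M] out of [2(4 beta - 1)]. *)
Lemma qnet_ge_weight_linear g1 g2 g3 g4 s1 s2 s3 s4 m L M :
  quad_data g1 g2 g3 g4 m -> 0 <= L -> L <= M ->
  share_lin L M g1 s1 -> share_lin L M g2 s2 -> share_lin L M g3 s3 ->
  share_lin L M g4 s4 ->
  (1 < (beta < g1)%R + (beta < g2)%R + (beta < g3)%R + (beta < g4)%R)%N ->
  L * ((weight (beta < g1) (beta < g2) (beta < g3) (beta < g4) true)%:R - 1)
    <= qnet g1 g2 g3 g4 s1 s2 s3 s4.
Proof.
move=> [[? ? ? ?] [? ? ? ?] _ ?] L0 LM.
case=> z1 ? ? ?; case=> z2 ? ? ?; case=> z3 ? ? ?; case=> z4 ? ? ?.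
clear beta_ge beta_lt; rewrite /qnet /cut3 /weight.
move: z1 z2 z3 z4.
case: (lerP g1 beta) => ? z1; case: (lerP g2 beta) => ? z2;
   case: (lerP g3 beta) => ? z3; case: (lerP g4 beta) => ? z4; rewrite /addn //=;
   rewrite ?(z1 isT) ?(z2 isT) ?(z3 isT) ?(z4 isT); clear z1 z2 z3 z4 => _; lra.
Qed.

Lemma qnet_ge_weight g1 g2 g3 g4 s1 s2 s3 s4 m (f : bool) :
  quad_data g1 g2 g3 g4 m ->
  share_bounded g1 s1 -> share_bounded g2 s2 -> share_bounded g3 s3 ->
  share_bounded g4 s4 ->
  m <= 2 - 5*beta ->
  ([/\ s1 = 0, s2 = 0, s3 = 0 & s4 = 0] \/
   (1 < (beta < g1)%R + (beta < g2)%R + (beta < g3)%R + (beta < g4)%R)%N /\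
   (((beta < g1)%R + (beta < g2)%R + (beta < g3)%R + (beta < g4)%R == 2)%N -> f)) ->
  lam beta * m *
    ((weight (beta < g1) (beta < g2) (beta < g3) (beta < g4) f)%:R - 1)
    <= qnet g1 g2 g3 g4 s1 s2 s3 s4.
Proof.
move: beta_ge beta_lt => bg bl q b1 b2 b3 b4 hm.
have [_ [a1 a2 a3 a4] m0 _] := q.
have l0 := lam_ge0 bg bl; have room := lam_room bg bl.
have L0 : 0 <= lam beta * m by exact: mulr_ge0.
have LM : lam beta * m <= lam beta * (2 - 5*beta) by exact: ler_wpM2l.
have L2 : lam beta * m <= 1/2 * m by apply: ler_wpM2r => //; exact: lam_le.
case=> [[-> -> -> ->]|[h hf]].
  by rewrite /qnet !addr0 subr0; apply: (cut3_sum_ge_weight _ q) => //; lra.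
apply: (@le_trans _ _ (lam beta * m *
    ((weight (beta < g1) (beta < g2) (beta < g3) (beta < g4) true)%:R - 1))).
  (* [f] matters only for two heavy triangles, and there [hf] makes it true. *)
  rewrite ler_wpM2l // lerD2r ler_nat; move: h hf; rewrite /weight.
  by case: (beta < g1)%R; case: (beta < g2)%R; case: (beta < g3)%R;
     case: (beta < g4)%R => //= _ /(_ isT) ->.
have lin g s : share_bounded g s -> g - beta <= m -> share_lin (lam beta * m) (lam beta * (2 - 5*beta)) g s.
  by move=> b gm; have [_ z s1' s2' s3'] := share_linear b gm m0; split.
apply: (qnet_ge_weight_linear (m := m) (M := lam beta * (2 - 5*beta))) => //; exact: lin.
Qed.

(** With at most two heavy triangles the term [2m] covers [g - beta + s <= m] for each. With three
    or four the gain is at least [4 beta - 1] or twice that, and a share is at most a third of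
    [4 beta - 1]. *)
Lemma qnet_ge0 g1 g2 g3 g4 s1 s2 s3 s4 m :
  quad_data g1 g2 g3 g4 m ->
  share_bounded g1 s1 -> share_bounded g2 s2 -> share_bounded g3 s3 ->
  share_bounded g4 s4 ->
  2*(1 - 3*beta) <= m -> 0 <= qnet g1 g2 g3 g4 s1 s2 s3 s4.
Proof.
move: beta_ge beta_lt => bg bl [[? ? ? ?] [a1 a2 a3 a4] m0 ?] b1 b2 b3 b4 hm.
have key g s : share_bounded g s -> g - beta <= m ->
    [/\ 0 <= s, g <= beta -> s = 0, g - beta + s <= m & 3*s <= 4*beta - 1].
  move=> b gm; have [_ _ _ hx _] := b; have [s0 z ? ? ?] := share_linear b gm m0.
  split => //; last by lra.
  have [k|k] := lerP s 0; first by lra.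
  by have := hx k; lra.
have [? z1 ? ?] := key _ _ b1 a1.
have [? z2 ? ?] := key _ _ b2 a2.
have [? z3 ? ?] := key _ _ b3 a3.
have [? z4 ? ?] := key _ _ b4 a4.
clear key b1 b2 b3 b4 beta_ge beta_lt.
rewrite /qnet /cut3; move: z1 z2 z3 z4.
by case: (lerP g1 beta) => ? z1; case: (lerP g2 beta) => ? z2;
   case: (lerP g3 beta) => ? z3; case: (lerP g4 beta) => ? z4;
   rewrite ?(z1 isT) ?(z2 isT) ?(z3 isT) ?(z4 isT); clear z1 z2 z3 z4; lra.
Qed.
End Shares.

(** * Averages and normalised codegrees *)

(** A Boolean quantifier, so that the 1024 patterns of heavy triangles are checked by evaluation. *)
Definition forall_bool (P : bool -> bool) : bool := P true && P false.

Lemma forall_boolP P : forall_bool P -> forall b, P b.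
Proof. by case/andP=> Pt Pf [|]. Qed.

(* [tijk] says that the triangle [ijk] of a 5-clique is heavy. *)
Lemma weight_sum_ge (t123 t124 t125 t134 t135 t145 t234 t235 t245 t345 : bool) :
  let f12 := [&& t123, t124 & t125] in
  let f13 := [&& t123, t134 & t135] in
  let f14 := [&& t124, t134 & t145] in
  let f15 := [&& t125, t135 & t145] in
  let f23 := [&& t123, t234 & t235] in
  let f24 := [&& t124, t234 & t245] in
  let f25 := [&& t125, t235 & t245] in
  let f34 := [&& t134, t234 & t345] in
  let f35 := [&& t135, t235 & t345] in
  let f45 := [&& t145, t245 & t345] in
  (5 <= weight t123 t124 t134 t234 [|| f12, f13, f14, f23, f24 | f34]
      + weight t123 t125 t135 t235 [|| f12, f13, f15, f23, f25 | f35]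
      + weight t124 t125 t145 t245 [|| f12, f14, f15, f24, f25 | f45]
      + weight t134 t135 t145 t345 [|| f13, f14, f15, f34, f35 | f45]
      + weight t234 t235 t245 t345 [|| f23, f24, f25, f34, f35 | f45])%N.
Proof.
move: t345; apply: forall_boolP; move: t245; apply: forall_boolP.
move: t235; apply: forall_boolP; move: t234; apply: forall_boolP.
move: t145; apply: forall_boolP; move: t135; apply: forall_boolP.
move: t134; apply: forall_boolP; move: t125; apply: forall_boolP.
move: t124; apply: forall_boolP; move: t123; apply: forall_boolP.
by vm_compute.
Qed.

Section Average.
Variable R : realFieldType.

Definition avg (X : finType) (f : X -> R) : R := (\sum_x f x) / #|X|%:R.

Lemma eq_avg (X : finType) (f g : X -> R) : f =1 g -> avg f = avg g.
Proof. by move=> fg; rewrite /avg (eq_bigr g). Qed.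

Lemma avgD (X : finType) (f g : X -> R) : avg (fun x => f x + g x) = avg f + avg g.
Proof. by rewrite /avg big_split mulrDl. Qed.

Lemma avgN (X : finType) (f : X -> R) : avg (fun x => - f x) = - avg f.
Proof. by rewrite /avg sumrN mulNr. Qed.

Lemma avgB (X : finType) (f g : X -> R) : avg (fun x => f x - g x) = avg f - avg g.
Proof. by rewrite avgD avgN. Qed.

Lemma avgZ (X : finType) c (f : X -> R) : avg (fun x => c * f x) = c * avg f.
Proof. by rewrite /avg -mulr_sumr mulrA. Qed.

Lemma avg_le (X : finType) (f g : X -> R) : (forall x, f x <= g x) -> avg f <= avg g.
Proof.
move=> fg; apply: ler_wpM2r; first by rewrite invr_ge0 ler0n.
by apply: ler_sum.
Qed.

Lemma avg_ge0 (X : finType) (f : X -> R) : (forall x, 0 <= f x) -> 0 <= avg f.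
Proof. by move=> f0; apply: mulr_ge0; rewrite ?invr_ge0 ?ler0n // sumr_ge0. Qed.

Lemma avg_eq0 (X : finType) (f : X -> R) :
  (forall x, 0 <= f x) -> avg f = 0 -> forall x, f x = 0.
Proof.
move=> f0 /eqP; rewrite mulf_eq0 invr_eq0 pnatr_eq0 => /orP[/eqP s0 x|].
  by apply: (psumr_eq0P (P := xpredT) (F := f)).
by move=> /eqP/card0_eq X0 x; have := X0 x.
Qed.

Lemma avg_neq0 (X : finType) (f : X -> R) : avg f != 0 -> exists x, f x != 0.
Proof.
move=> h; apply/existsP; apply: contraNT h; rewrite negb_exists => /forallP h.
rewrite /avg big1 ?mul0r // => x _.
by have := h x; rewrite negbK => /eqP.
Qed.

Lemma avg_perm (X : finType) (h : X -> X) (f : X -> R) :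
  bijective h -> avg (fun x => f (h x)) = avg f.
Proof. by move=> hb; rewrite /avg [in RHS](reindex h) //; apply: onW_bij. Qed.

Lemma avg_pair (X Y : finType) (f : X * Y -> R) :
  avg f = avg (fun x => avg (fun y => f (x, y))).
Proof.
have fE : \sum_p f p = \sum_x \sum_y f (x, y).
  by rewrite pair_bigA; apply: eq_bigr => -[].
by rewrite /avg card_prod natrM invfM fE -[in RHS]mulr_suml mulrA mulrAC.
Qed.
End Average.

Section Densities.
Variables (R : realFieldType) (T : finType) (e : rel T).
Hypothesis e_sym : symmetric e.
Hypothesis (T_gt0 : (0 < #|T|)%N).

Definition adj x y : R := (e x y)%:R.
Definition clique3 x y z : R := adj x y * adj x z * adj y z.
Definition clique4 x y z t : R := clique3 x y z * (adj x t * adj y t * adj z t).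
Definition clique5 x y z t s : R := clique4 x y z t * (adj x s * adj y s * adj z s * adj t s).
(** Codegrees are taken for all tuples, not only for cliques: the bounds on them are averages of
    pointwise inequalities and hold for any vertices. *)
Definition codeg1 x : R := avg (fun y => adj x y).
Definition codeg2 x y : R := avg (fun z => adj x z * adj y z).
Definition codeg3 x y z : R := avg (fun t => adj x t * adj y t * adj z t).
Definition codeg4 x y z t : R := avg (fun s => adj x s * adj y s * adj z s * adj t s).

Lemma avg_cst (c : R) : avg (fun _ : T => c) = c.
Proof.
by rewrite /avg sumr_const -[c *+ _]mulr_natr mulfK // pnatr_eq0 -lt0n.
Qed.

Lemma adjC x y : adj x y = adj y x. Proof. by rewrite /adj e_sym. Qed.

Lemma adj01 x y : adj x y = 0 \/ adj x y = 1.
Proof. by rewrite /adj; case: (e x y); [right|left]. Qed.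

Ltac solve01 := repeat match goal with |- context [adj ?x ?y] =>
  case: (adj01 x y) => -> end; lra.

Lemma D2_ge x y : codeg1 x + codeg1 y - 1 <= codeg2 x y.
Proof.
rewrite -[1]avg_cst -avgD -avgB; apply: avg_le => z; solve01.
Qed.

Lemma D3_ge_edge x y z : codeg2 x y + codeg1 z - 1 <= codeg3 x y z.
Proof. rewrite -[1]avg_cst -avgD -avgB; apply: avg_le => t; solve01. Qed.

Lemma D4_ge_triangle x y z t : codeg3 x y z + codeg1 t - 1 <= codeg4 x y z t.
Proof. rewrite -[1]avg_cst -avgD -avgB; apply: avg_le => s; solve01. Qed.

Lemma D2C x y : codeg2 x y = codeg2 y x.
Proof. by apply: eq_avg => z; rewrite mulrC. Qed.

Lemma D3C23 x y z : codeg3 x y z = codeg3 x z y.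
Proof. by apply: eq_avg => t; rewrite mulrAC. Qed.

Lemma D3C12 x y z : codeg3 x y z = codeg3 y x z.
Proof. by apply: eq_avg => t; rewrite [adj x t * _]mulrC. Qed.

Lemma D3_le x y z : codeg3 x y z <= codeg2 x y.
Proof. apply: avg_le => t; solve01. Qed.

Lemma D4_le x y z t : [/\ codeg4 x y z t <= codeg3 x y z, codeg4 x y z t <= codeg3 x y t,
  codeg4 x y z t <= codeg3 x z t & codeg4 x y z t <= codeg3 y z t].
Proof. by split; apply: avg_le => s; solve01. Qed.

Lemma D3_le1 x y z : codeg3 x y z <= 1.
Proof. rewrite -[1]avg_cst; apply: avg_le => s; solve01. Qed.

Lemma D4_ge0 x y z t : 0 <= codeg4 x y z t.
Proof. apply: avg_ge0 => s; solve01. Qed.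

(* If a vertex is adjacent to [i] of the three, then ['C(i, 2) >= i - 1 + (i == 3)]. *)
Lemma D2_sum_ge x y z :
  codeg1 x + codeg1 y + codeg1 z - 1 + codeg3 x y z <= codeg2 x y + codeg2 x z + codeg2 y z.
Proof. rewrite -[1]avg_cst -!avgD -avgB -!avgD; apply: avg_le => s; solve01. Qed.

(** If a vertex is adjacent to [i] of the four, then ['C(i, 3) >= i - 2 + 2 * (i == 4)]. *)
Lemma D3_sum_ge x y z t :
  codeg1 x + codeg1 y + codeg1 z + codeg1 t - 2 + 2 * codeg4 x y z t
  <= codeg3 x y z + codeg3 x y t + codeg3 x z t + codeg3 y z t.
Proof. rewrite -{1}[2]avg_cst -avgZ -!avgD -avgB -!avgD; apply: avg_le => s; solve01. Qed.
End Densities.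

(** * The 5-clique inequality *)

(** For a 4-clique inside a 5-clique, [e] marks the heavy edges, [t] the heavy triangles, and [f]
    the edges whose three triangles in the 5-clique are all heavy. *)
Lemma heavy_edge_weight (t1 t2 t3 t4 e12 e13 e14 e23 e24 e34 f12 f13 f14 f23 f24 f34 : bool) :
  (e12 -> [&& t1, t2 & f12]) -> (e13 -> [&& t1, t3 & f13]) ->
  (e14 -> [&& t2, t3 & f14]) -> (e23 -> [&& t1, t4 & f23]) ->
  (e24 -> [&& t2, t4 & f24]) -> (e34 -> [&& t3, t4 & f34]) ->
  [|| e12, e13, e14, e23, e24 | e34] ->
  (1 < t1 + t2 + t3 + t4)%N /\
  ((t1 + t2 + t3 + t4 == 2)%N -> [|| f12, f13, f14, f23, f24 | f34]).
Proof.
case: e12 => [/(_ isT)/and3P[-> -> ->] /= *|_]; first by case: (t3) (t4) => -[].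
case: e13 => [/(_ isT)/and3P[-> -> ->] /= *|_]; first by case: (t2) (t4) => -[]; rewrite ?orbT.
case: e14 => [/(_ isT)/and3P[-> -> ->] /= *|_]; first by case: (t1) (t4) => -[]; rewrite ?orbT.
case: e23 => [/(_ isT)/and3P[-> -> ->] /= *|_]; first by case: (t2) (t3) => -[]; rewrite ?orbT.
case: e24 => [/(_ isT)/and3P[-> -> ->] /= *|_]; first by case: (t1) (t3) => -[]; rewrite ?orbT.
by case: e34 => [/(_ isT)/and3P[-> -> ->] /= *|//]; case: (t1) (t2) => -[]; rewrite ?orbT.
Qed.

Section Pointwise.
Variables (R : realFieldType) (T : finType) (e : rel T) (beta : R).
Hypothesis T_gt0 : (0 < #|T|)%N.
Hypotheses (beta_ge : 1/4 <= beta) (beta_lt : beta < 1/3).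
Hypothesis (min_deg : forall x, 1 - beta <= codeg1 R e x).

Local Notation A := (adj R e).
Local Notation D2 := (codeg2 R e).
Local Notation D3 := (codeg3 R e).
Local Notation D4 := (codeg4 R e).

Definition triangle_net x y z := tnet beta (D2 x y) (D2 x z) (D2 y z) (D3 x y z).
Definition triangle_share x y z := share beta (D2 x y) (D2 x z) (D2 y z) (D3 x y z).
Definition quad_net x y z t :=
  qnet beta (D3 x y z) (D3 x y t) (D3 x z t) (D3 y z t)
    (triangle_share x y z) (triangle_share x y t) (triangle_share x z t) (triangle_share y z t).

Lemma D2_ge_min x y : 1 - 2*beta <= D2 x y.
Proof. have := D2_ge R e T_gt0 x y; have := min_deg x; have := min_deg y; lra. Qed.

Lemma D3_ge_D2 x y z : [/\ D2 x y - beta <= D3 x y z, D2 x z - beta <= D3 x y z &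
  D2 y z - beta <= D3 x y z].
Proof.
have h u v w : D2 u v - beta <= D3 u v w.
  by have := D3_ge_edge R e T_gt0 u v w; have := min_deg w; lra.
split; first exact: h.
  by rewrite D3C23; exact: h.
by rewrite D3C12 D3C23; exact: h.
Qed.

Lemma triangle_dataP x y z : triangle_data beta (D2 x y) (D2 x z) (D2 y z) (D3 x y z).
Proof.
have [h1 h2 h3] := D3_ge_D2 x y z.
have d2 := D2_ge_min x y.
split; rewrite ?D2_ge_min //.
- split; first exact: D3_le.
    by rewrite D3C23; exact: D3_le.
  by rewrite D3C12 D3C23; exact: D3_le.
- have := D2_sum_ge R e T_gt0 x y z.
  by have := min_deg x; have := min_deg y; have := min_deg z; lra.
- by split; [lra | exact: D3_le1].
Qed.

Lemma D3_ge_min x y z : 1 - 3*beta <= D3 x y z.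
Proof. by have [_ _ _ _ []] := triangle_dataP x y z. Qed.

Lemma D4_ge_D3 x y z t : D3 x y z - beta <= D4 x y z t.
Proof. by have := D4_ge_triangle R e T_gt0 x y z t; have := min_deg t; lra. Qed.

Lemma D4C34 x y z t : D4 x y z t = D4 x y t z.
Proof. by apply: eq_avg => s; rewrite mulrAC. Qed.
Lemma D4C23 x y z t : D4 x y z t = D4 x z y t.
Proof. by apply: eq_avg => s; rewrite [A x s * _ * _]mulrAC. Qed.
Lemma D4C12 x y z t : D4 x y z t = D4 y x z t.
Proof. by apply: eq_avg => s; rewrite [A x s * _]mulrC. Qed.

Lemma D4_ge_D3s x y z t : [/\ D3 x y z - beta <= D4 x y z t,
  D3 x y t - beta <= D4 x y z t, D3 x z t - beta <= D4 x y z t &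
  D3 y z t - beta <= D4 x y z t].
Proof.
split; first exact: D4_ge_D3.
- by rewrite D4C34; exact: D4_ge_D3.
- by rewrite D4C23 D4C34; exact: D4_ge_D3.
- by rewrite D4C12 D4C23 D4C34; exact: D4_ge_D3.
Qed.

Lemma quad_dataP x y z t :
  quad_data beta (D3 x y z) (D3 x y t) (D3 x z t) (D3 y z t) (D4 x y z t).
Proof.
split; [by split; exact: D3_ge_min | exact: D4_ge_D3s | exact: D4_ge0 |].
have := D3_sum_ge R e T_gt0 x y z t.
by have := min_deg x; have := min_deg y; have := min_deg z; have := min_deg t; lra.
Qed.

Lemma triangle_shareP x y z : share_bounded beta (D3 x y z) (triangle_share x y z).
Proof. exact: shareP (triangle_dataP x y z). Qed.

Lemma quad_net_ge0_of_codeg4 x y z t : 2*(1 - 3*beta) <= D4 x y z t -> 0 <= quad_net x y z t.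
Proof. by apply: (qnet_ge0 _ _ (quad_dataP x y z t)); rewrite //; exact: triangle_shareP. Qed.

(** Passing to the common triangle can only raise the codegree, and adding [s] lowers it by at most
    [beta]. *)
Lemma D4_shift x y z t s : [/\ D4 x y z t - beta <= D4 x y z s,
  D4 x y z t - beta <= D4 x y t s, D4 x y z t - beta <= D4 x z t s &
  D4 x y z t - beta <= D4 y z t s].
Proof.
have [l1 l2 l3 l4] := D4_le R e x y z t.
have [h1 _ _ _] := D4_ge_D3s x y z s; have [h2 _ _ _] := D4_ge_D3s x y t s.
have [h3 _ _ _] := D4_ge_D3s x z t s; have [h4 _ _ _] := D4_ge_D3s y z t s.
by split; lra.
Qed.

Lemma heavy_edge x y z : 2*beta < D2 x y ->
  [/\ beta < D3 x y z, beta < D3 x z y & beta < D3 z x y].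
Proof.
have [h _ _] := D3_ge_D2 x y z => k.
by rewrite [D3 x z y]D3C23 [D3 z x y]D3C12 [D3 x z y]D3C23; split; lra.
Qed.

Lemma triangle_share0_or_heavy x y z : triangle_share x y z = 0 \/
  [|| 2*beta < D2 x y, 2*beta < D2 x z | 2*beta < D2 y z].
Proof.
have [->|h] := eqVneq (triangle_share x y z) 0; first by left.
by right; exact: share_heavy (triangle_dataP x y z) h.
Qed.

Lemma quad_share_heavy x y z t (f12 f13 f14 f23 f24 f34 : bool) :
  (2*beta < D2 x y -> f12) -> (2*beta < D2 x z -> f13) -> (2*beta < D2 x t -> f14) ->
  (2*beta < D2 y z -> f23) -> (2*beta < D2 y t -> f24) -> (2*beta < D2 z t -> f34) ->
  [/\ triangle_share x y z = 0, triangle_share x y t = 0, triangle_share x z t = 0 & triangle_share y z t = 0] \/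
  (1 < (beta < D3 x y z)%R + (beta < D3 x y t)%R + (beta < D3 x z t)%R + (beta < D3 y z t)%R)%N /\
  (((beta < D3 x y z)%R + (beta < D3 x y t)%R + (beta < D3 x z t)%R + (beta < D3 y z t)%R == 2)%N
    -> [|| f12, f13, f14, f23, f24 | f34]).
Proof.
move=> k12 k13 k14 k23 k24 k34.
have [h|h] := boolP [|| 2*beta < D2 x y, 2*beta < D2 x z, 2*beta < D2 x t,
  2*beta < D2 y z, 2*beta < D2 y t | 2*beta < D2 z t].
  right; apply: heavy_edge_weight h => h.
  - by have [-> _ _] := heavy_edge z h; have [-> _ _] := heavy_edge t h; rewrite k12.
  - by have [_ -> _] := heavy_edge y h; have [-> _ _] := heavy_edge t h; rewrite k13.
  - by have [_ -> _] := heavy_edge y h; have [_ -> _] := heavy_edge z h; rewrite k14.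
  - by have [_ _ ->] := heavy_edge x h; have [-> _ _] := heavy_edge t h; rewrite k23.
  - by have [_ _ ->] := heavy_edge x h; have [_ -> _] := heavy_edge z h; rewrite k24.
  - by have [_ _ ->] := heavy_edge x h; have [_ _ ->] := heavy_edge y h; rewrite k34.
left; move: h; rewrite !negb_or => /and5P[/negbTE h1 /negbTE h2 /negbTE h3 /negbTE h4 /andP[/negbTE h5 /negbTE h6]].
by split; [case: (triangle_share0_or_heavy x y z)|case: (triangle_share0_or_heavy x y t)|
  case: (triangle_share0_or_heavy x z t)|case: (triangle_share0_or_heavy y z t)];
  rewrite ?h1 ?h2 ?h3 ?h4 ?h5 ?h6.
Qed.

Lemma heavy_full x y z t s : 2*beta < D2 x y ->
  [&& beta < D3 x y z, beta < D3 x y t & beta < D3 x y s].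
Proof.
by move=> h; have [-> _ _] := heavy_edge z h; have [-> _ _] := heavy_edge t h;
   have [-> _ _] := heavy_edge s h.
Qed.

Ltac permute_last3 := first [ assumption | rewrite D4C34; assumption
  | rewrite D4C23; assumption | rewrite D4C23 D4C34; assumption
  | rewrite D4C34 D4C23; assumption | rewrite D4C34 D4C23 D4C34; assumption ].
Ltac permute_D4 := first [ permute_last3 | rewrite D4C12; permute_last3
  | rewrite D4C23 D4C12; permute_last3 | rewrite D4C34 D4C23 D4C12; permute_last3 ].

Lemma clique5_net_ge0 x y z t s :
  0 < D4 x y z t -> 0 < D4 x y z s -> 0 < D4 x y t s -> 0 < D4 x z t s -> 0 < D4 y z t s ->
  0 <= quad_net x y z t / D4 x y z t + quad_net x y z s / D4 x y z s + quad_net x y t s / D4 x y t s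
       + quad_net x z t s / D4 x z t s + quad_net y z t s / D4 y z t s.
Proof.
move: beta_ge beta_lt => bg bl p1 p2 p3 p4 p5.
have sum_ge0 (n1 n2 n3 n4 n5 m1 m2 m3 m4 m5 : R) : 0 < m1 -> 0 < m2 -> 0 < m3 -> 0 < m4 -> 0 < m5 ->
    0 <= n1 -> 0 <= n2 -> 0 <= n3 -> 0 <= n4 -> 0 <= n5 ->
    0 <= n1/m1 + n2/m2 + n3/m3 + n4/m4 + n5/m5.
  by move=> *; rewrite !addr_ge0 // divr_ge0 // ltW.
have big (q1 q2 q3 q4 q5 : R) : 2 - 5*beta < q1 ->
    q1 - beta <= q2 -> q1 - beta <= q3 -> q1 - beta <= q4 -> q1 - beta <= q5 ->
    [/\ 2*(1-3*beta) <= q1, 2*(1-3*beta) <= q2, 2*(1-3*beta) <= q3,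
     2*(1-3*beta) <= q4 & 2*(1-3*beta) <= q5].
  by move=> *; split; lra.
(* Since [2 - 5 beta = 2(1 - 3 beta) + beta], one codegree above it puts all five above
   [2(1 - 3 beta)]. *)
have [h1|h1] := ltrP (2 - 5*beta) (D4 x y z t).
  have [l2 l3 l4 l5] := D4_shift x y z t s.
  have [k1 k2 k3 k4 k5] := big _ _ _ _ _ h1 l2 l3 l4 l5.
  by apply: sum_ge0 => //; apply: quad_net_ge0_of_codeg4 => //; permute_D4.
have [h2|h2] := ltrP (2 - 5*beta) (D4 x y z s).
  have [l2 l3 l4 l5] := D4_shift x y z s t.
  have [k1 k2 k3 k4 k5] := big _ _ _ _ _ h2 l2 l3 l4 l5.
  by apply: sum_ge0 => //; apply: quad_net_ge0_of_codeg4 => //; permute_D4.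
have [h3|h3] := ltrP (2 - 5*beta) (D4 x y t s).
  have [l2 l3 l4 l5] := D4_shift x y t s z.
  have [k1 k2 k3 k4 k5] := big _ _ _ _ _ h3 l2 l3 l4 l5.
  by apply: sum_ge0 => //; apply: quad_net_ge0_of_codeg4 => //; permute_D4.
have [h4|h4] := ltrP (2 - 5*beta) (D4 x z t s).
  have [l2 l3 l4 l5] := D4_shift x z t s y.
  have [k1 k2 k3 k4 k5] := big _ _ _ _ _ h4 l2 l3 l4 l5.
  by apply: sum_ge0 => //; apply: quad_net_ge0_of_codeg4 => //; permute_D4.
have [h5|h5] := ltrP (2 - 5*beta) (D4 y z t s).
  have [l2 l3 l4 l5] := D4_shift y z t s x.
  have [k1 k2 k3 k4 k5] := big _ _ _ _ _ h5 l2 l3 l4 l5.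
  by apply: sum_ge0 => //; apply: quad_net_ge0_of_codeg4 => //; permute_D4.
have W := weight_sum_ge (beta < D3 x y z) (beta < D3 x y t) (beta < D3 x y s)
  (beta < D3 x z t) (beta < D3 x z s) (beta < D3 x t s) (beta < D3 y z t)
  (beta < D3 y z s) (beta < D3 y t s) (beta < D3 z t s).
have F12 := @heavy_full x y z t s.
have F13 : 2*beta < D2 x z -> [&& beta < D3 x y z, beta < D3 x z t & beta < D3 x z s].
  by rewrite [D3 x y z]D3C23; exact: heavy_full.
have F14 : 2*beta < D2 x t -> [&& beta < D3 x y t, beta < D3 x z t & beta < D3 x t s].
  by rewrite [D3 x y t]D3C23 [D3 x z t]D3C23; exact: heavy_full.
have F15 : 2*beta < D2 x s -> [&& beta < D3 x y s, beta < D3 x z s & beta < D3 x t s].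
  by rewrite [D3 x y s]D3C23 [D3 x z s]D3C23 [D3 x t s]D3C23; exact: heavy_full.
have F23 : 2*beta < D2 y z -> [&& beta < D3 x y z, beta < D3 y z t & beta < D3 y z s].
  by rewrite [D3 x y z]D3C12 [D3 y x z]D3C23; exact: heavy_full.
have F24 : 2*beta < D2 y t -> [&& beta < D3 x y t, beta < D3 y z t & beta < D3 y t s].
  by rewrite [D3 x y t]D3C12 [D3 y x t]D3C23 [D3 y z t]D3C23; exact: heavy_full.
have F25 : 2*beta < D2 y s -> [&& beta < D3 x y s, beta < D3 y z s & beta < D3 y t s].
  by rewrite [D3 x y s]D3C12 [D3 y x s]D3C23 [D3 y z s]D3C23 [D3 y t s]D3C23; exact: heavy_full.
have F34 : 2*beta < D2 z t -> [&& beta < D3 x z t, beta < D3 y z t & beta < D3 z t s].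
  by rewrite [D3 x z t]D3C12 [D3 z x t]D3C23 [D3 y z t]D3C12 [D3 z y t]D3C23; exact: heavy_full.
have F35 : 2*beta < D2 z s -> [&& beta < D3 x z s, beta < D3 y z s & beta < D3 z t s].
  by rewrite [D3 x z s]D3C12 [D3 z x s]D3C23 [D3 y z s]D3C12 [D3 z y s]D3C23 [D3 z t s]D3C23;
     exact: heavy_full.
have F45 : 2*beta < D2 t s -> [&& beta < D3 x t s, beta < D3 y t s & beta < D3 z t s].
  by rewrite [D3 x t s]D3C12 [D3 t x s]D3C23 [D3 y t s]D3C12 [D3 t y s]D3C23
     [D3 z t s]D3C12 [D3 t z s]D3C23; exact: heavy_full.
have key u v w r (f : bool) (p : 0 < D4 u v w r) (h : D4 u v w r <= 2 - 5*beta)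
    (c : [/\ triangle_share u v w = 0, triangle_share u v r = 0, triangle_share u w r = 0 & triangle_share v w r = 0] \/
      (1 < (beta < D3 u v w)%R + (beta < D3 u v r)%R + (beta < D3 u w r)%R + (beta < D3 v w r)%R)%N /\
      (((beta < D3 u v w)%R + (beta < D3 u v r)%R + (beta < D3 u w r)%R + (beta < D3 v w r)%R == 2)%N
        -> f)) :
    lam beta * ((weight (beta < D3 u v w) (beta < D3 u v r) (beta < D3 u w r) (beta < D3 v w r) f)%:R - 1)
    <= quad_net u v w r / D4 u v w r.
  rewrite ler_pdivlMr // mulrAC.
  exact: (qnet_ge_weight beta_ge beta_lt (quad_dataP u v w r) (triangle_shareP _ _ _) (triangle_shareP _ _ _)
      (triangle_shareP _ _ _) (triangle_shareP _ _ _) h c).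
have q1 := key _ _ _ _ _ p1 h1 (quad_share_heavy F12 F13 F14 F23 F24 F34).
have q2 := key _ _ _ _ _ p2 h2 (quad_share_heavy F12 F13 F15 F23 F25 F35).
have q3 := key _ _ _ _ _ p3 h3 (quad_share_heavy F12 F14 F15 F24 F25 F45).
have q4 := key _ _ _ _ _ p4 h4 (quad_share_heavy F13 F14 F15 F34 F35 F45).
have q5 := key _ _ _ _ _ p5 h5 (quad_share_heavy F23 F24 F25 F34 F35 F45).
(* Each weight exceeds its balance by one unit, so a total weight of at least 5 makes the sum
   nonnegative. *)
apply: le_trans (lerD (lerD (lerD (lerD q1 q2) q3) q4) q5).
rewrite -!mulrDr; apply: mulr_ge0; first exact: lam_ge0.
by move: W; cbv zeta; rewrite -(ler_nat R) !natrD; lra.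
Qed.
End Pointwise.

(** * Double counting *)

Section Global.
Variables (R : realFieldType) (T : finType) (e : rel T) (beta : R).
Hypothesis e_sym : symmetric e.

Local Notation A := (adj R e).
Local Notation D2 := (codeg2 R e).
Local Notation D3 := (codeg3 R e).
Local Notation D4 := (codeg4 R e).
Local Notation C3 := (clique3 R e).
Local Notation C4 := (clique4 R e).
Local Notation C5 := (clique5 R e).

Definition avg2 (f : T -> T -> R) : R := avg (fun p : T * T => f p.1 p.2).
Definition avg3 (f : T -> T -> T -> R) : R :=
  avg (fun p : T * T * T => f p.1.1 p.1.2 p.2).
Definition avg4 (f : T -> T -> T -> T -> R) : R :=
  avg (fun p : T * T * T * T => f p.1.1.1 p.1.1.2 p.1.2 p.2).
Definition avg5 (f : T -> T -> T -> T -> T -> R) : R :=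
  avg (fun p : T * T * T * T * T => f p.1.1.1.1 p.1.1.1.2 p.1.1.2 p.1.2 p.2).

Lemma C3_C23 x y z : C3 x z y = C3 x y z.
Proof. by rewrite /clique3 (adjC R e_sym z y); ring. Qed.
Lemma C3_C12 x y z : C3 y x z = C3 x y z.
Proof. by rewrite /clique3 (adjC R e_sym y x); ring. Qed.
Lemma C4_C34 x y z t : C4 x y t z = C4 x y z t.
Proof. by rewrite /clique4 /clique3 (adjC R e_sym t z); ring. Qed.
Lemma C4_C23 x y z t : C4 x z y t = C4 x y z t.
Proof. by rewrite /clique4 /clique3 (adjC R e_sym z y); ring. Qed.
Lemma C4_C12 x y z t : C4 y x z t = C4 x y z t.
Proof. by rewrite /clique4 /clique3 (adjC R e_sym y x); ring. Qed.
Lemma C5_C45 x y z t s : C5 x y z s t = C5 x y z t s.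
Proof. by rewrite /clique5 /clique4 /clique3 (adjC R e_sym s t); ring. Qed.
Lemma C5_C34 x y z t s : C5 x y t z s = C5 x y z t s.
Proof. by rewrite /clique5 /clique4 /clique3 (adjC R e_sym t z); ring. Qed.
Lemma C5_C23 x y z t s : C5 x z y t s = C5 x y z t s.
Proof. by rewrite /clique5 /clique4 /clique3 (adjC R e_sym z y); ring. Qed.
Lemma C5_C12 x y z t s : C5 y x z t s = C5 x y z t s.
Proof. by rewrite /clique5 /clique4 /clique3 (adjC R e_sym y x); ring. Qed.

Lemma avg3_edge f : avg3 (fun x y z => C3 x y z * f x y) = avg2 (fun x y => A x y * f x y * D2 x y).
Proof.
rewrite /avg3 avg_pair; apply: eq_avg => -[x y] /=; rewrite -avgZ; apply: eq_avg => z.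
by rewrite /clique3; ring.
Qed.

Lemma avg4_triangle f : avg4 (fun x y z t => C4 x y z t * f x y z)
  = avg3 (fun x y z => C3 x y z * f x y z * D3 x y z).
Proof.
rewrite /avg4 avg_pair; apply: eq_avg => -[[x y] z] /=; rewrite -avgZ; apply: eq_avg => t.
by rewrite /clique4; ring.
Qed.

Lemma avg5_quad f : avg5 (fun x y z t s => C5 x y z t s * f x y z t)
  = avg4 (fun x y z t => C4 x y z t * f x y z t * D4 x y z t).
Proof.
rewrite /avg5 avg_pair; apply: eq_avg => -[[[x y] z] t] /=; rewrite -avgZ; apply: eq_avg => s.
by rewrite /clique5; ring.
Qed.

Lemma avg3_sym f : avg3 (fun x y z => C3 x y z * f x z) = avg3 (fun x y z => C3 x y z * f x y) /\
  avg3 (fun x y z => C3 x y z * f y z) = avg3 (fun x y z => C3 x y z * f x y).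
Proof.
split.
- rewrite /avg3 -(avg_perm (h := fun p : T * T * T => (p.1.1, p.2, p.1.2))); last first.
    by exists (fun p : T * T * T => (p.1.1, p.2, p.1.2)) => -[[x y] z].
  by apply: eq_avg => -[[x y] z] /=; rewrite C3_C23.
- rewrite /avg3 -(avg_perm (h := fun p : T * T * T => (p.2, p.1.1, p.1.2))); last first.
    by exists (fun p : T * T * T => (p.1.2, p.2, p.1.1)) => -[[x y] z].
  by apply: eq_avg => -[[x y] z] /=; rewrite C3_C12 C3_C23.
Qed.

Lemma avg4_sym f :
  [/\ avg4 (fun x y z t => C4 x y z t * f x y t) = avg4 (fun x y z t => C4 x y z t * f x y z),
      avg4 (fun x y z t => C4 x y z t * f x z t) = avg4 (fun x y z t => C4 x y z t * f x y z) &
      avg4 (fun x y z t => C4 x y z t * f y z t) = avg4 (fun x y z t => C4 x y z t * f x y z)].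
Proof.
split.
- rewrite /avg4 -(avg_perm (h := fun p : T * T * T * T => (p.1.1, p.2, p.1.2))); last first.
    by exists (fun p : T * T * T * T => (p.1.1, p.2, p.1.2)) => -[[[x y] z] t].
  by apply: eq_avg => -[[[x y] z] t] /=; rewrite C4_C34.
- rewrite /avg4 -(avg_perm (h := fun p : T * T * T * T => (p.1.1.1, p.2, p.1.1.2, p.1.2))); last first.
    by exists (fun p : T * T * T * T => (p.1.1.1, p.1.2, p.2, p.1.1.2)) => -[[[x y] z] t].
  by apply: eq_avg => -[[[x y] z] t] /=; rewrite C4_C23 C4_C34.
- rewrite /avg4 -(avg_perm (h := fun p : T * T * T * T => (p.2, p.1.1.1, p.1.1.2, p.1.2))); last first.
    by exists (fun p : T * T * T * T => (p.1.1.2, p.1.2, p.2, p.1.1.1)) => -[[[x y] z] t].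
  by apply: eq_avg => -[[[x y] z] t] /=; rewrite C4_C12 C4_C23 C4_C34.
Qed.

Lemma avg5_sym f : let rhs := avg5 (fun x y z t s => C5 x y z t s * f x y z t) in
  [/\ avg5 (fun x y z t s => C5 x y z t s * f x y z s) = rhs,
      avg5 (fun x y z t s => C5 x y z t s * f x y t s) = rhs,
      avg5 (fun x y z t s => C5 x y z t s * f x z t s) = rhs &
      avg5 (fun x y z t s => C5 x y z t s * f y z t s) = rhs].
Proof.
move=> rhs; rewrite /rhs; split.
- rewrite /avg5 -(avg_perm (h := fun p : T * T * T * T * T => (p.1.1, p.2, p.1.2))); last first.
    by exists (fun p : T * T * T * T * T => (p.1.1, p.2, p.1.2)) => -[[[[x y] z] t] s].
  by apply: eq_avg => -[[[[x y] z] t] s] /=; rewrite C5_C45.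
- rewrite /avg5 -(avg_perm (h := fun p : T * T * T * T * T => (p.1.1.1, p.2, p.1.1.2, p.1.2))); last first.
    by exists (fun p : T * T * T * T * T => (p.1.1.1, p.1.2, p.2, p.1.1.2)) => -[[[[x y] z] t] s].
  by apply: eq_avg => -[[[[x y] z] t] s] /=; rewrite C5_C34 C5_C45.
- rewrite /avg5 -(avg_perm (h := fun p : T * T * T * T * T => (p.1.1.1.1, p.2, p.1.1.1.2, p.1.1.2, p.1.2))); last first.
    by exists (fun p : T * T * T * T * T => (p.1.1.1.1, p.1.1.2, p.1.2, p.2, p.1.1.1.2)) => -[[[[x y] z] t] s].
  by apply: eq_avg => -[[[[x y] z] t] s] /=; rewrite C5_C23 C5_C34 C5_C45.
- rewrite /avg5 -(avg_perm (h := fun p : T * T * T * T * T => (p.2, p.1.1.1.1, p.1.1.1.2, p.1.1.2, p.1.2))); last first.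
    by exists (fun p : T * T * T * T * T => (p.1.1.1.2, p.1.1.2, p.1.2, p.2, p.1.1.1.1)) => -[[[[x y] z] t] s].
  by apply: eq_avg => -[[[[x y] z] t] s] /=; rewrite C5_C12 C5_C23 C5_C34 C5_C45.
Qed.

Definition density2 : R := avg2 A.
Definition density3 : R := avg3 C3.
Definition density4 : R := avg4 C4.

Lemma A_ge0 x y : 0 <= A x y. Proof. exact: ler0n. Qed.
Lemma C3_ge0 x y z : 0 <= C3 x y z. Proof. by rewrite !mulr_ge0 ?A_ge0. Qed.
Lemma C4_ge0 x y z t : 0 <= C4 x y z t. Proof. by rewrite !mulr_ge0 ?A_ge0. Qed.
Lemma C5_ge0 x y z t s : 0 <= C5 x y z t s. Proof. by rewrite !mulr_ge0 ?A_ge0. Qed.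

Lemma density3E : density3 = avg2 (fun x y => A x y * D2 x y).
Proof.
rewrite -[RHS](_ : avg2 (fun x y => A x y * 1 * D2 x y) = _); last by apply: eq_avg => p; rewrite mulr1.
by rewrite -(avg3_edge (fun _ _ => 1)); apply: eq_avg => p; rewrite mulr1.
Qed.

Lemma density4E : density4 = avg3 (fun x y z => C3 x y z * D3 x y z).
Proof.
rewrite -[RHS](_ : avg3 (fun x y z => C3 x y z * 1 * D3 x y z) = _); last by apply: eq_avg => p; rewrite mulr1.
by rewrite -(avg4_triangle (fun _ _ _ => 1)); apply: eq_avg => p; rewrite mulr1.
Qed.

Definition trunc2 x y := cut2 beta (D2 x y).
Definition trunc3 x y z := cut3 beta (D3 x y z).
Definition quad_gain x y z t := trunc3 x y z + trunc3 x y t + trunc3 x z t + trunc3 y z t - (2 - 4*beta).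
Definition trunc3_gap x y z := (trunc3 x y z - (1 - 3*beta)) * (beta - trunc3 x y z).
Definition trunc2_gap x y := (trunc2 x y - (1 - 2*beta)) * (2*beta - trunc2 x y).
Definition triangle_slack x y z := trunc2 x y + trunc2 x z + trunc2 y z - (2 - 3*beta) - trunc3 x y z.
Definition edge_excess x y := (D2 x y - trunc2 x y) / D2 x y.

Definition trunc3_mass := avg3 (fun x y z => C3 x y z * trunc3 x y z).
Definition excess3_mass := avg3 (fun x y z => C3 x y z * (D3 x y z - trunc3 x y z)).
Definition gap3_mass := avg3 (fun x y z => C3 x y z * trunc3_gap x y z).
Definition gap2_mass := avg2 (fun x y => A x y * trunc2_gap x y).
Definition trunc2_mass := avg2 (fun x y => A x y * trunc2 x y).
Definition excess2_mass := avg2 (fun x y => A x y * (D2 x y - trunc2 x y)).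
Definition gain_mass := avg4 (fun x y z t => C4 x y z t * quad_gain x y z t).
Definition slack_mass := avg3 (fun x y z => C3 x y z * triangle_slack x y z).

Lemma trunc3_excess3_mass : trunc3_mass + excess3_mass = density4.
Proof. by rewrite density4E /trunc3_mass /excess3_mass /avg3 -avgD; apply: eq_avg => p; ring. Qed.

Lemma trunc2_excess2_mass : trunc2_mass + excess2_mass = density3.
Proof. by rewrite density3E /trunc2_mass /excess2_mass /avg2 -avgD; apply: eq_avg => p; ring. Qed.

(** Truncation gives [m * (D - m) = beta * (D - m)], since [m] is [D] or [beta]; [m * m] is then
    expanded through the gap. *)
Lemma trunc3_codeg3 x y z : trunc3 x y z * D3 x y z =
  (1 - 2*beta) * trunc3 x y z - (1 - 3*beta)*beta - trunc3_gap x y z + beta * (D3 x y z - trunc3 x y z).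
Proof. by rewrite /trunc3_gap /trunc3 /cut3; case: lerP => h; ring. Qed.

Lemma trunc2_codeg2 x y : trunc2 x y * D2 x y =
  trunc2 x y - 2*beta*(1 - 2*beta) - trunc2_gap x y + 2*beta * (D2 x y - trunc2 x y).
Proof. by rewrite /trunc2_gap /trunc2 /cut2; case: lerP => h; ring. Qed.

Lemma gain_mass_eq : gain_mass = 2*(1-2*beta) * trunc3_mass - 4*(1-3*beta)*beta*density3 - 4*gap3_mass + 2*(4*beta-1)*excess3_mass.
Proof.
have [h1 h2 h3] := avg4_sym trunc3.
have -> : gain_mass = 4 * avg4 (fun x y z t => C4 x y z t * trunc3 x y z) - (2 - 4*beta) * density4.
  rewrite [4 * _](_ : _ = avg4 (fun x y z t => C4 x y z t * trunc3 x y z) +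
    avg4 (fun x y z t => C4 x y z t * trunc3 x y t) + avg4 (fun x y z t => C4 x y z t * trunc3 x z t)
    + avg4 (fun x y z t => C4 x y z t * trunc3 y z t)); last by rewrite h1 h2 h3; ring.
  by rewrite /gain_mass /density4 /avg4 -!avgD -avgZ -avgB; apply: eq_avg => p; rewrite /quad_gain; ring.
rewrite avg4_triangle -trunc3_excess3_mass.
have -> : avg3 (fun x y z => C3 x y z * trunc3 x y z * D3 x y z) =
  (1 - 2*beta) * trunc3_mass - (1-3*beta)*beta*density3 - gap3_mass + beta * excess3_mass.
  rewrite /trunc3_mass /density3 /gap3_mass /excess3_mass /avg3 -!avgZ -!avgB -avgD.
  by apply: eq_avg => p; rewrite -mulrA trunc3_codeg3; ring.
by ring.
Qed.

Lemma avg2_trunc2_codeg2 : avg2 (fun x y => A x y * trunc2 x y * D2 x y) =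
  trunc2_mass - 2*beta*(1-2*beta)*density2 - gap2_mass + 2*beta*excess2_mass.
Proof.
rewrite /trunc2_mass /density2 /gap2_mass /excess2_mass /avg2 -!avgZ -!avgB -avgD.
by apply: eq_avg => p; rewrite -mulrA trunc2_codeg2; ring.
Qed.

Lemma slack_mass_eq : slack_mass = 3 * (trunc2_mass - 2*beta*(1-2*beta)*density2 - gap2_mass + 2*beta*excess2_mass)
  - (2-3*beta)*density3 - trunc3_mass.
Proof.
have [h1 h2] := avg3_sym trunc2.
rewrite -avg2_trunc2_codeg2 -avg3_edge.
rewrite [3 * _](_ : _ = avg3 (fun x y z => C3 x y z * trunc2 x y) +
  avg3 (fun x y z => C3 x y z * trunc2 x z) + avg3 (fun x y z => C3 x y z * trunc2 y z)); last first.
  by rewrite h1 h2; ring.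
rewrite /slack_mass /density3 /trunc3_mass /avg3 -!avgD -avgZ -!avgB; apply: eq_avg => p.
by rewrite /triangle_slack; ring.
Qed.
End Global.

(** * The two inequalities *)

Section Inequalities.
Variables (R : realFieldType) (T : finType) (e : rel T) (beta : R).
Hypotheses (e_sym : symmetric e) (T_gt0 : (0 < #|T|)%N).
Hypotheses (beta_ge : 1/4 <= beta) (beta_lt : beta < 1/3).
Hypothesis (min_deg : forall x, 1 - beta <= codeg1 R e x).

Local Notation A := (adj R e).
Local Notation D2 := (codeg2 R e).
Local Notation D3 := (codeg3 R e).
Local Notation D4 := (codeg4 R e).
Local Notation C3 := (clique3 R e).
Local Notation C4 := (clique4 R e).
Local Notation C5 := (clique5 R e).
Local Notation K2 := (density2 R e).
Local Notation K3 := (density3 R e).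
Local Notation K4 := (density4 R e).
Local Notation sh := (triangle_share e beta).
Local Notation tn := (triangle_net e beta).
Local Notation net := (quad_net e beta).
Local Notation m2 := (trunc2 e beta).
Local Notation m3 := (trunc3 e beta).
Local Notation S2 := (trunc2_gap e beta).
Local Notation S3 := (trunc3_gap e beta).
Local Notation F4 := (quad_gain e beta).
Local Notation mY := (excess3_mass e beta).
Local Notation mY2 := (excess2_mass e beta).
Local Notation mS2 := (gap2_mass e beta).
Local Notation mS3 := (gap3_mass e beta).
Local Notation mF := (gain_mass e beta).
Local Notation msl := (slack_mass e beta).
Local Notation excess := (edge_excess e beta).

Let D2_min := D2_ge_min T_gt0 min_deg.
Let D3_min := D3_ge_min T_gt0 min_deg.
Let qd := quad_dataP T_gt0 min_deg.
Let td := triangle_dataP T_gt0 min_deg.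

Lemma trunc3_gap_ge0 x y z : 0 <= S3 x y z.
Proof.
move: beta_ge beta_lt (D3_min x y z) => bg bl h.
by rewrite /trunc3_gap /trunc3 /cut3; case: (lerP (D3 x y z) beta) => k; apply: mulr_ge0; lra.
Qed.

Lemma trunc2_gap_ge0 x y : 0 <= S2 x y.
Proof.
move: beta_ge beta_lt (D2_min x y) => bg bl h.
by rewrite /trunc2_gap /trunc2 /cut2; case: (lerP (D2 x y) (2*beta)) => k; apply: mulr_ge0; lra.
Qed.

Lemma quad_gain_ge0 x y z t : 0 <= F4 x y z t.
Proof. by rewrite subr_ge0; exact: (cut3_sum_ge beta_ge beta_lt (qd x y z t)). Qed.

Lemma trunc3_le x y z : 0 <= D3 x y z - m3 x y z.
Proof. by rewrite subr_ge0 /trunc3 /cut3 ge_min lexx. Qed.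

Lemma trunc2_le x y : 0 <= D2 x y - m2 x y.
Proof. by rewrite subr_ge0 /trunc2 /cut2 ge_min lexx. Qed.

Lemma gain_mass_ge0 : 0 <= mF.
Proof. by apply: avg_ge0 => p; rewrite mulr_ge0 ?C4_ge0 ?quad_gain_ge0. Qed.
Lemma gap3_mass_ge0 : 0 <= mS3.
Proof. by apply: avg_ge0 => p; rewrite mulr_ge0 ?C3_ge0 ?trunc3_gap_ge0. Qed.
Lemma excess3_mass_ge0 : 0 <= mY.
Proof. by apply: avg_ge0 => p; rewrite mulr_ge0 ?C3_ge0 ?trunc3_le. Qed.
Lemma gap2_mass_ge0 : 0 <= mS2.
Proof. by apply: avg_ge0 => p; rewrite mulr_ge0 ?A_ge0 ?trunc2_gap_ge0. Qed.
Lemma excess2_mass_ge0 : 0 <= mY2.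
Proof. by apply: avg_ge0 => p; rewrite mulr_ge0 ?A_ge0 ?trunc2_le. Qed.

(** [trunc3_mass] cancels, leaving three nonnegative terms; they give the inequality and vanish
    separately in the equality case. *)
Lemma density34_eq :
  2*(1-2*beta)*K4 - 4*(1-3*beta)*beta*K3 = mF + 4*mS3 + 4*(1-3*beta)*mY.
Proof. by rewrite (gain_mass_eq beta e_sym) -(trunc3_excess3_mass e beta); ring. Qed.

Theorem density4_ge_density3 : 4*(1-3*beta)*beta*K3 <= 2*(1-2*beta)*K4.
Proof.
move: beta_ge beta_lt => bg bl; rewrite -subr_ge0 density34_eq.
have := gain_mass_ge0; have := gap3_mass_ge0.
have : 0 <= (1-3*beta)*mY by apply: mulr_ge0; [lra | exact: excess3_mass_ge0].
by lra.
Qed.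

Definition triangle_net_mass := avg3 (fun x y z => C3 x y z * tn x y z).
Definition share_mass := avg3 (fun x y z => C3 x y z * sh x y z * D3 x y z).
Definition quad_net_mass := avg4 (fun x y z t => C4 x y z t * net x y z t).

Lemma triangle_net_mass_eq : triangle_net_mass = (1-2*beta)/2 * msl + bud beta/2 * (3*mY2) - (4*beta-1)/2*mY.
Proof.
move: beta_ge beta_lt => bg bl.
have [h1 h2] := avg3_sym e_sym excess.
(* The excess of an edge is spread evenly over the triangles on it; their number is proportional to
   [D2], the denominator in [excess]. *)
have -> : mY2 = avg3 (fun x y z => C3 x y z * excess x y).
  rewrite avg3_edge; apply: eq_avg => p; rewrite -mulrA mulfVK //.
  by apply: lt0r_neq0; have := D2_min p.1 p.2; lra.
rewrite [3 * _](_ : _ = avg3 (fun x y z => C3 x y z * excess x y) +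
  avg3 (fun x y z => C3 x y z * excess x z) + avg3 (fun x y z => C3 x y z * excess y z)); last first.
  by rewrite h1 h2; ring.
rewrite /triangle_net_mass /slack_mass /excess3_mass /avg3 -!avgD -!avgZ -avgD -avgB; apply: eq_avg => p.
rewrite /triangle_net /tnet /triangle_slack /edge_excess /trunc2 /trunc3; ring.
Qed.

Lemma quad_net_mass_eq : quad_net_mass = mF - 4*share_mass.
Proof.
have [h1 h2 h3] := avg4_sym e_sym sh.
rewrite /share_mass -avg4_triangle [4 * _](_ : _ = avg4 (fun x y z t => C4 x y z t * sh x y z) +
  avg4 (fun x y z t => C4 x y z t * sh x y t) + avg4 (fun x y z t => C4 x y z t * sh x z t) +
  avg4 (fun x y z t => C4 x y z t * sh y z t)); last by rewrite h1 h2 h3; ring.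
rewrite /quad_net_mass /gain_mass /avg4 -!avgD -avgB; apply: eq_avg => p.
by rewrite /quad_net /qnet /quad_gain /trunc3; ring.
Qed.

(** The part [(1 - 3 beta)/36] withheld in [bud] reappears as the last term, by
    [3/2 * 1/36 = 1/24]. *)
Lemma total_eq : (1-beta)/2*K3 - 3*beta*(1-2*beta)^+2*K2 =
  mF/4 + mS3 + 3/2*(1-2*beta)*mS2 + triangle_net_mass + (1-3*beta)/24*mY2.
Proof.
rewrite triangle_net_mass_eq (gain_mass_eq beta e_sym) (slack_mass_eq beta e_sym) /bud -(trunc2_excess2_mass e beta).
by field.
Qed.

Lemma triangle_net_add_share_ge0 x y z : 0 <= tn x y z + sh x y z * D3 x y z.
Proof.
move: beta_ge beta_lt => bg bl.
rewrite /triangle_share /share mulfVK; last by apply: lt0r_neq0; have := D3_min x y z; lra.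
by rewrite /triangle_net; case: (lerP 0 (- tnet beta (D2 x y) (D2 x z) (D2 y z) (D3 x y z))); lra.
Qed.

Lemma triangle_net_share_ge0 : 0 <= triangle_net_mass + share_mass.
Proof.
rewrite /triangle_net_mass /share_mass /avg3 -avgD; apply: avg_ge0 => p.
by rewrite -mulrA -mulrDr mulr_ge0 ?C3_ge0 ?triangle_net_add_share_ge0.
Qed.

Lemma C5_D4_gt0 x y z t s : C5 x y z t s != 0 ->
  [/\ 0 < D4 x y z t, 0 < D4 x y z s, 0 < D4 x y t s, 0 < D4 x z t s & 0 < D4 y z t s].
Proof.
have pos a b c d u : A a u * A b u * A c u * A d u != 0 -> 0 < D4 a b c d.
  move=> h; rewrite lt_def D4_ge0 andbT; apply: contra_neq h => h.
  apply: (avg_eq0 (f := fun u => A a u * A b u * A c u * A d u) _ h u).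
  by move=> v; rewrite !mulr_ge0 ?A_ge0.
rewrite /clique5 /clique4 /clique3 !mulf_eq0 !negb_or -!andbA.
move=> /and5P[xy xz yz xt /and5P[yt zt xs ys /andP[zs ts]]].
split; [apply: (pos _ _ _ _ s)|apply: (pos _ _ _ _ t)|apply: (pos _ _ _ _ z)
  |apply: (pos _ _ _ _ y)|apply: (pos _ _ _ _ x)];
by rewrite !mulf_neq0 // adjC.
Qed.

Lemma quad_net_mass_ge0 : 0 <= quad_net_mass.
Proof.
move: beta_ge beta_lt => bg bl.
pose f x y z t := net x y z t / D4 x y z t.
(* Handing [net / D4] to every 5-clique passes on the full balance, except for 4-cliques with
   [D4 = 0], which keep theirs. *)
have le : avg5 (fun x y z t s => C5 x y z t s * f x y z t) <= quad_net_mass.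
  rewrite avg5_quad; apply: avg_le => p.
  rewrite -mulrA; apply: ler_wpM2l; first exact: C4_ge0.
  rewrite /f; have [z|nz] := eqVneq (D4 p.1.1.1 p.1.1.2 p.1.2 p.2) 0; last by rewrite mulfVK.
  (* If [D4 = 0], no triangle of the 4-clique is heavy, so no share is charged and its balance is
     its gain. *)
  rewrite z mulr0; apply: le_trans (quad_gain_ge0 p.1.1.1 p.1.1.2 p.1.2 p.2) _.
  have [_ [h1 h2 h3 h4] _ _] := qd p.1.1.1 p.1.1.2 p.1.2 p.2.
  have sz u v w : D3 u v w - beta <= 0 -> sh u v w = 0.
    by move=> h; have [_ k _ _ _] := triangle_shareP T_gt0 beta_ge beta_lt min_deg u v w; apply: k; lra.
  by rewrite /quad_net /qnet /quad_gain /trunc3 !sz -?z //; lra.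
apply: le_trans le.
have [h1 h2 h3 h4] := avg5_sym e_sym f.
rewrite -(pmulr_rge0 _ (_ : 0 < 5)) //.
rewrite [5 * _](_ : _ = avg5 (fun x y z t s => C5 x y z t s * f x y z t) +
  avg5 (fun x y z t s => C5 x y z t s * f x y z s) + avg5 (fun x y z t s => C5 x y z t s * f x y t s) +
  avg5 (fun x y z t s => C5 x y z t s * f x z t s) + avg5 (fun x y z t s => C5 x y z t s * f y z t s));
  last by rewrite h1 h2 h3 h4; ring.
rewrite /avg5 -!avgD; apply: avg_ge0 => -[[[[x y] z] t] s] /=.
rewrite -!mulrDr; have [->|nz] := eqVneq (C5 x y z t s) 0; first by rewrite mul0r.
have [p1 p2 p3 p4 p5] := C5_D4_gt0 nz.
by apply: mulr_ge0; [exact: C5_ge0 | exact: clique5_net_ge0].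
Qed.

Theorem density23_gap :
  (1-3*beta)/24*mY2 <= (1-beta)/2*K3 - 3*beta*(1-2*beta)^+2*K2.
Proof.
move: beta_ge beta_lt => bg bl; rewrite total_eq.
have := quad_net_mass_ge0; rewrite quad_net_mass_eq; have := triangle_net_share_ge0; have := gap3_mass_ge0.
have : 0 <= (1-2*beta)*mS2 by apply: mulr_ge0; [lra | exact: gap2_mass_ge0].
by lra.
Qed.

Theorem density3_ge_density2 : 6*beta*(1-2*beta)^+2*K2 <= (1-beta)*K3.
Proof.
move: beta_ge beta_lt => bg bl.
have := density23_gap; have : 0 <= (1-3*beta)*mY2 by apply: mulr_ge0; [lra | exact: excess2_mass_ge0].
by lra.
Qed.

Theorem density23_equality : 6*beta*(1-2*beta)^+2*K2 = (1-beta)*K3 ->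
  4*(1-3*beta)*beta*K3 = 2*(1-2*beta)*K4.
Proof.
move: beta_ge beta_lt => bg bl eq.
have a0 : 0 < 1 - 3*beta by lra.
have aY : (1-3*beta)*mY2 <= 0 by have := density23_gap; lra.
have Y20 : mY2 = 0.
  by apply/eqP; rewrite eq_le excess2_mass_ge0 -(pmulr_rle0 _ a0) aY.
have light x y : A x y != 0 -> D2 x y <= 2*beta.
  move=> nz; have := avg_eq0 _ Y20 => /(_ _ (x, y)) /= h.
  have /eqP : A x y * (D2 x y - m2 x y) = 0.
    by apply: h => p; rewrite mulr_ge0 ?A_ge0 ?trunc2_le.
  rewrite mulf_eq0 (negbTE nz) /= subr_eq0 /trunc2 /cut2 => /eqP ->.
  by rewrite ge_min lexx orbT.
(* With all edges light, [tnet_light] turns [total_eq] into a sum of nonnegative terms equal to 0,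
   which kills exactly the terms of [density34_eq]. *)
have aN : (1-3*beta)*mY <= triangle_net_mass.
  rewrite /excess3_mass /triangle_net_mass /avg3 -avgZ; apply: avg_le => -[[x y] z] /=.
  have [->|nz] := eqVneq (C3 x y z) 0; first by rewrite !mul0r mulr0.
  rewrite mulrCA; apply: ler_wpM2l; first exact: C3_ge0.
  move: nz; rewrite /clique3 !mulf_eq0 !negb_or -andbA => /and3P[xy xz yz].
  exact: tnet_light (td x y z) (light _ _ xy) (light _ _ xz) (light _ _ yz).
have Y0 := excess3_mass_ge0.
have s2 : 0 <= (1-2*beta)*mS2 by apply: mulr_ge0; [lra | exact: gap2_mass_ge0].
have tot := total_eq; rewrite Y20 mulr0 addr0 in tot.
have F0 := gain_mass_ge0; have S0 := gap3_mass_ge0.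
have aY0 : 0 <= (1-3*beta)*mY by apply: mulr_ge0 => //; lra.
have := density34_eq.
by lra.
Qed.

Theorem density34_equality : 4*(1-3*beta)*beta*K3 = 2*(1-2*beta)*K4 ->
  (forall x y z, C3 x y z != 0 -> D3 x y z = 1 - 3*beta \/ D3 x y z = beta) /\
  (forall x y z t, C4 x y z t != 0 ->
     D3 x y z + D3 x y t + D3 x z t + D3 y z t = 2 - 4*beta).
Proof.
move: beta_ge beta_lt => bg bl eq.
have F0 := gain_mass_ge0; have S0 := gap3_mass_ge0.
have a0 : 0 < 1 - 3*beta by lra.
have aY0 : 0 <= (1-3*beta)*mY by apply: mulr_ge0; [lra | exact: excess3_mass_ge0].
have K := density34_eq.
have F1 : mF = 0 by lra.
have S1 : mS3 = 0 by lra.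
have Y1 : mY = 0.
  have /eqP : (1-3*beta)*mY = 0 by lra.
  by rewrite mulf_eq0 gt_eqF //= => /eqP.
have D3m x y z : C3 x y z != 0 -> m3 x y z = D3 x y z.
  move=> nz; have := avg_eq0 _ Y1 => /(_ _ (x, y, z)) /= h.
  have /eqP : C3 x y z * (D3 x y z - m3 x y z) = 0.
    by apply: h => p; rewrite mulr_ge0 ?C3_ge0 ?trunc3_le.
  by rewrite mulf_eq0 (negbTE nz) /= subr_eq0 => /eqP.
split.
- move=> x y z nz; have := avg_eq0 _ S1 => /(_ _ (x, y, z)) /= h.
  have /eqP : C3 x y z * S3 x y z = 0.
    by apply: h => p; rewrite mulr_ge0 ?C3_ge0 ?trunc3_gap_ge0.
  rewrite mulf_eq0 (negbTE nz) /= /trunc3_gap D3m // mulf_eq0 !subr_eq0.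
  by case/orP=> /eqP; [left | right].
- move=> x y z t nz; have := avg_eq0 _ F1 => /(_ _ (x, y, z, t)) /= h.
  have /eqP : C4 x y z t * F4 x y z t = 0.
    by apply: h => p; rewrite mulr_ge0 ?C4_ge0 ?quad_gain_ge0.
  rewrite mulf_eq0 (negbTE nz) /= /quad_gain subr_eq0 => /eqP <-.
  move: nz; rewrite /clique4 /clique3 !mulf_eq0 !negb_or -!andbA => /and5P[xy xz yz xt /andP[yt zt]].
  by rewrite !D3m // /clique3 !mulf_neq0.
Qed.
End Inequalities.

(** * Counting cliques *)

Section CliqueCount.
Variables (T : finType) (e : rel T).
Hypotheses (e_sym : symmetric e) (e_irr : irreflexive e).

Lemma pairwise_clique (s : seq T) :
  pairwise e s = uniq s && is_clique e [set x in s].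
Proof.
elim: s => [|x s IH] /=.
  by apply/esym/forall_inP => x; rewrite inE.
rewrite IH; apply/and3P/andP => [[/allP xs us cs]|[/andP[xs us] cs]].
  split; first by rewrite us andbT; apply/negP => /xs; rewrite e_irr.
  apply/forall_inP => y; rewrite !inE => yP; apply/forall_inP => z; rewrite !inE => zP.
  apply/implyP => yz.
  case/orP: yP yz => [/eqP->|ys] yz.
    by case/orP: zP yz => [/eqP->|zs _]; [rewrite eqxx | exact: xs].
  case/orP: zP yz => [/eqP-> _|zs yz]; first by rewrite e_sym; exact: xs.
  by move/forall_inP: cs => /(_ y); rewrite inE => /(_ ys)/forall_inP/(_ z);
     rewrite inE => /(_ zs); rewrite yz.
split => //.
  apply/allP => y ys; move/forall_inP: cs => /(_ x); rewrite !inE eqxx => /(_ isT).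
  move/forall_inP => /(_ y); rewrite !inE ys orbT => /(_ isT)/implyP; apply.
  by apply: contraNneq xs => ->.
apply/forall_inP => y; rewrite inE => ys; apply/forall_inP => z; rewrite inE => zs.
move/forall_inP: cs => /(_ y); rewrite !inE ys orbT => /(_ isT)/forall_inP/(_ z).
by rewrite !inE zs orbT => /(_ isT).
Qed.

Lemma card_pairwise r : #|[set t : r.-tuple T | pairwise e t]| = (r`! * kr e r)%N.
Proof.
rewrite /kr /kr_in mulnC -sum_nat_const -sum1_card.
rewrite (partition_big (fun t : r.-tuple T => [set x in t])
  (mem [set S : {set T} | [&& S \subset setT, #|S| == r & is_clique e S]])) /=; last first.
  move=> t; rewrite inE pairwise_clique => /andP[ut ct].
  by rewrite inE subsetT ct andbT cardsE (card_uniqP ut) size_tuple eqxx.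
apply: eq_bigr => S; rewrite inE subsetT /= => /andP[/eqP Sr Sc].
rewrite sum1dep_card -[r`!](_ : #|S| ^_ r = _)%N; last by rewrite Sr ffactnn.
rewrite -card_uniq_tuples; apply: eq_card => t; rewrite !inE pairwise_clique.
apply/andP/andP => [[/andP[ut _] /eqP <-]|[/allP tS ut]].
  split => //; apply/allP => x xt.
  by have : x \in [set y in t] by rewrite inE.
have SE : [set x in t] = S.
  apply/eqP; rewrite eqEcard Sr cardsE (card_uniqP ut) size_tuple leqnn andbT.
  by apply/subsetP => x; rewrite inE => /tS.
by rewrite SE ut Sc.
Qed.

Variable R : realFieldType.

Hypothesis T_gt0 : (0 < #|T|)%N.

Let n_neq0 : #|T|%:R != 0 :> R.
Proof. by rewrite pnatr_eq0 -lt0n. Qed.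

Lemma sum_pairwise r (X : finType) (h : X -> r.-tuple T) (f : X -> R) :
  bijective h -> (forall x, f x = (pairwise e (h x))%:R) ->
  \sum_x f x = (r`! * kr e r)%:R.
Proof.
move=> [g gK hK] fE.
rewrite -card_pairwise -sum1dep_card natr_sum [RHS]big_mkcond (reindex h) /=; last first.
  by exists g => x _; [exact: gK | exact: hK].
by apply: eq_bigr => x _; rewrite fE; case: (pairwise _ _).
Qed.

Lemma kr_density2 : #|T|%:R ^+ 2 * density2 R e = 2 * (kr e 2)%:R.
Proof.
rewrite /density2 /avg2 /avg card_prod natrM -expr2 mulrC mulfVK ?expf_neq0 //.
rewrite (sum_pairwise (r := 2) (h := fun p : T * T => [tuple p.1; p.2])) ?natrM //.
  exists (fun t : 2.-tuple T => (thead t, thead (behead_tuple t))) => [[x y] //|t].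
  by case/tupleP: t => x t; case/tupleP: t => y t; rewrite !tuple0; apply: val_inj.
by case=> x y /=; rewrite /adj !andbT.
Qed.

Lemma kr_density3 : #|T|%:R ^+ 3 * density3 R e = 6 * (kr e 3)%:R.
Proof.
rewrite /density3 /avg3 /avg !card_prod !natrM -expr2 -exprSr mulrC mulfVK ?expf_neq0 //.
rewrite (sum_pairwise (r := 3) (h := fun p : T * T * T => [tuple p.1.1; p.1.2; p.2])) ?natrM //.
  exists (fun t : 3.-tuple T => (thead t, thead (behead_tuple t), thead (behead_tuple (behead_tuple t))))
    => [[[x y] z] //|t].
  case/tupleP: t => x t; case/tupleP: t => y t; case/tupleP: t => z t.
  by rewrite !tuple0; apply: val_inj.
case=> [[x y] z] /=; rewrite /clique3 /adj.
by case: (e x y); case: (e x z); case: (e y z); rewrite !(mulr0, mulr1, mul0r).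
Qed.

Lemma kr_density4 : #|T|%:R ^+ 4 * density4 R e = 24 * (kr e 4)%:R.
Proof.
rewrite /density4 /avg4 /avg !card_prod !natrM -expr2 -!exprSr mulrC mulfVK ?expf_neq0 //.
rewrite (sum_pairwise (r := 4) (h := fun p : T * T * T * T => [tuple p.1.1.1; p.1.1.2; p.1.2; p.2]))
  ?natrM //.
  exists (fun t : 4.-tuple T => (thead t, thead (behead_tuple t), thead (behead_tuple (behead_tuple t)),
      thead (behead_tuple (behead_tuple (behead_tuple t))))) => [[[[x y] z] u] //|t].
  case/tupleP: t => x t; case/tupleP: t => y t; case/tupleP: t => z t; case/tupleP: t => u t.
  by rewrite !tuple0; apply: val_inj.
case=> [[[x y] z] u] /=; rewrite /clique4 /clique3 /adj.
by case: (e x y); case: (e x z); case: (e y z); case: (e x u); case: (e y u); case: (e z u);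
  rewrite !(mulr0, mulr1, mul0r).
Qed.
End CliqueCount.

Section Transport.
Variables (T1 T2 : finType) (h : T1 -> T2) (e1 : rel T1) (e2 : rel T2).
Hypotheses (h_inj : injective h) (e_h : forall x y, e1 x y = e2 (h x) (h y)).

Lemma is_clique_imset (S : {set T1}) : is_clique e2 (h @: S) = is_clique e1 S.
Proof.
apply/forall_inP/forall_inP => H x xS; apply/forall_inP => y yS.
  have := H _ (imset_f h xS) => /forall_inP/(_ _ (imset_f h yS)).
  by rewrite (inj_eq h_inj) e_h.
case/imsetP: xS => x' xS ->; case/imsetP: yS => y' yS ->.
by rewrite (inj_eq h_inj) -e_h; have /forall_inP := H _ xS; apply.
Qed.

Lemma kr_in_imset (X : {set T1}) r : kr_in e2 (h @: X) r = kr_in e1 X r.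
Proof.
rewrite /kr_in -[RHS](card_imset _ (imset_inj h_inj)).
apply: eq_card => S; rewrite !inE; apply/idP/imsetP => [/and3P[SX Sr Sc]|[S' + ->]].
  have SE : S = h @: (h @^-1: S).
    apply/setP => x; apply/idP/imsetP => [xS|[y + ->]]; last by rewrite inE.
    by have /imsetP[y _ xy] := subsetP SX _ xS; exists y => //; rewrite inE -xy.
  exists (h @^-1: S) => //; rewrite inE -is_clique_imset -SE Sc andbT.
  rewrite -(card_imset _ h_inj) -SE Sr andbT; apply/subsetP => x; rewrite inE => xS.
  by have /imsetP[y yX /h_inj->] := subsetP SX _ xS.
by rewrite inE is_clique_imset card_imset // => /and3P[SX -> ->]; rewrite imsetS.
Qed.

Lemma deg_in_imset (X : {set T1}) x : deg_in e2 (h @: X) (h x) = deg_in e1 X x.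
Proof.
rewrite /deg_in -[RHS](card_imset _ h_inj).
apply: eq_card => y; rewrite !inE; apply/andP/imsetP => [[/imsetP[z zX ->] xz]|[z + ->]].
  by exists z => //; rewrite inE zX e_h.
by rewrite inE => /andP[zX xz]; rewrite imset_f // -e_h.
Qed.
End Transport.

Lemma deg_inT (T : finType) (e : rel T) x : deg_in e setT x = deg e x.
Proof. by apply: eq_card => y; rewrite !inE. Qed.

Lemma kr_in3_eq0 (T : finType) (e : rel T) (X : {set T}) :
  symmetric e -> irreflexive e ->
  (kr_in e X 3 = 0%N) <->
  (forall x y z, x \in X -> y \in X -> z \in X -> e x y -> e x z -> e y z -> False).
Proof.
move=> e_sym e_irr; split.
  move=> /eqP; rewrite cards_eq0 => /eqP K x y z xX yX zX xy xz yz.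
  have pw : pairwise e [:: x; y; z] by rewrite /= xy xz yz.
  move: pw; rewrite (pairwise_clique e_sym e_irr) => /andP[us cs].
  have := in_set0 [set u in [:: x; y; z]]; rewrite -K inE cs andbT cardsE (card_uniqP us) eqxx andbT.
  by move/negbT/negP; apply; apply/subsetP => u; rewrite !inE => /or3P[]/eqP->.
move=> H; apply/eqP; rewrite cards_eq0 -subset0; apply/subsetP => S.
rewrite !inE => /and3P[/subsetP SX /eqP Sr Sc]; exfalso.
have cs : is_clique e [set u in enum S] by rewrite set_enum.
have : pairwise e (enum S) by rewrite (pairwise_clique e_sym e_irr) enum_uniq.
have : {subset enum S <= X} by move=> u; rewrite mem_enum => /SX.
have : size (enum S) = 3 by rewrite -cardE.
case: (enum S) => [|x [|y [|z [|]]]] //= _ sX.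
rewrite !andbT => /andP[/andP[xy xz] yz].
by apply: (H x y z) => //; apply: sX; rewrite !inE eqxx ?orbT.
Qed.

(** * Structure in the equality case *)

Section Structure.
Variables (R : realFieldType) (T : finType) (e : rel T) (beta : R) (d : nat).
Hypotheses (e_sym : symmetric e) (e_irr : irreflexive e) (T_gt0 : (0 < #|T|)%N).
Hypotheses (beta_ge : 1/4 <= beta) (beta_lt : beta < 1/3).
Hypotheses (dE : d%:R = (1 - beta) * #|T|%:R) (deg_ge : forall x, (d <= deg e x)%N).

Local Notation n := (#|T|%:R : R).
Local Notation A := (adj R e).
Local Notation D1 := (codeg1 R e).
Local Notation D3 := (codeg3 R e).
Local Notation D4 := (codeg4 R e).
Local Notation C3 := (clique3 R e).
Local Notation C4 := (clique4 R e).

Lemma n_gt0 : 0 < n. Proof. by rewrite ltr0n. Qed.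

Lemma avg_mem (S : {set T}) : avg (fun x => (x \in S)%:R : R) = #|S|%:R / n.
Proof.
by rewrite /avg -sum1_card natr_sum [in RHS]big_mkcond; congr (_ / _);
   apply: eq_bigr => x _; case: (x \in S).
Qed.

Lemma D1E x : D1 x = (deg e x)%:R / n.
Proof. by rewrite -avg_mem; apply: eq_avg => y; rewrite inE. Qed.

Lemma D1_ge x : 1 - beta <= D1 x.
Proof. by rewrite D1E ler_pdivlMr ?n_gt0 // -dE ler_nat. Qed.

Lemma A_neq0 x y : (A x y != 0) = e x y.
Proof. by rewrite pnatr_eq0 eqb0 negbK. Qed.

Lemma C3_neq0 x y z : (C3 x y z != 0) = [&& e x y, e x z & e y z].
Proof. by rewrite !mulf_eq0 !negb_or !A_neq0 -andbA. Qed.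

Lemma C4_neq0 x y z t :
  (C4 x y z t != 0) = [&& e x y, e x z, e y z, e x t, e y t & e z t].
Proof. by rewrite mulf_eq0 negb_or C3_neq0 !mulf_eq0 !negb_or !A_neq0 -!andbA. Qed.

Section Equality.
Hypothesis D3_sum : forall x y z t, C4 x y z t != 0 ->
  D3 x y z + D3 x y t + D3 x z t + D3 y z t = 2 - 4*beta.

(** The equality leaves no room in [D3_sum_ge]. *)
Lemma quad_exact x y z t : C4 x y z t != 0 -> D1 x = 1 - beta /\ D4 x y z t = 0.
Proof.
move=> /D3_sum h; have := D3_sum_ge R e T_gt0 x y z t; rewrite h.
have := D1_ge x; have := D1_ge y; have := D1_ge z; have := D1_ge t.
have : 0 <= D4 x y z t by exact: D4_ge0.
by move=> *; split; lra.
Qed.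

Lemma clique5_free x y z t s : C4 x y z t != 0 ->
  [&& e x s, e y s, e z s & e t s] = false.
Proof.
move=> nz; have [_ h] := quad_exact nz.
have : A x s * A y s * A z s * A t s = 0.
  apply: (avg_eq0 (f := fun s => A x s * A y s * A z s * A t s) _ h s).
  by move=> v; rewrite !mulr_ge0 ?A_ge0.
rewrite /adj; case: (e x s); case: (e y s); case: (e z s); case: (e t s) => //.
by rewrite !mulr1 => /eqP; rewrite oner_eq0.
Qed.

(** Greedy extension, as [1 - beta], [1 - 2 beta] and [1 - 3 beta] are positive. *)
Lemma clique4_through x : exists y z t, C4 x y z t != 0.
Proof.
move: beta_ge beta_lt => bg bl.
have [y xy] : exists y, A x y != 0.
  by apply: avg_neq0; apply: lt0r_neq0; have := D1_ge x; rewrite /codeg1; lra.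
have [z xyz] : exists z, A x z * A y z != 0.
  apply: avg_neq0; apply: lt0r_neq0; have := D2_ge_min T_gt0 D1_ge x y.
  by rewrite /codeg2; lra.
have [t xyzt] : exists t, A x t * A y t * A z t != 0.
  apply: avg_neq0; apply: lt0r_neq0; have := D3_ge_min T_gt0 D1_ge x y z.
  by rewrite /codeg3; lra.
by exists y, z, t; rewrite mulf_neq0 // /clique3 -mulrA mulf_neq0.
Qed.

Lemma deg_eq x : deg e x = d.
Proof.
have [y [z [t /quad_exact[h _]]]] := clique4_through x.
apply/eqP; rewrite -(eqr_nat R) dE -h D1E mulfVK //.
exact: lt0r_neq0 n_gt0.
Qed.

Lemma D1_eq x : D1 x = 1 - beta.
Proof. by have [y [z [t /quad_exact[h _]]]] := clique4_through x. Qed.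

Definition apex x y z : {set T} := [set v | [&& e x v, e y v & e z v]].

Lemma apex_part x y z : C3 x y z != 0 -> D3 x y z = beta ->
  #|apex x y z|%:R = beta * n /\
  (forall v u, v \in apex x y z -> e v u = (u \notin apex x y z)).
Proof.
move=> nz D3b; set V := apex x y z.
have cV : #|V|%:R / n = beta.
  rewrite -avg_mem -D3b; apply: eq_avg => v; rewrite inE /adj.
  by case: (e x v); case: (e y v); case: (e z v); rewrite ?mulr0 ?mulr1 ?mul0r.
split; first by rewrite -[in RHS]cV mulfVK //; exact: lt0r_neq0 n_gt0.
move=> v u vV.
have indep w : w \in V -> e v w = false.
  move: vV; rewrite !inE => /and3P[xv yv zv] /and3P[xw yw zw].
  have Q : C4 x y z v != 0.
    by move: nz; rewrite C3_neq0 C4_neq0 xv yv zv !andbT.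
  by have := clique5_free w Q; rewrite xw yw zw.
(* [v] has no neighbour in [V], and its degree equals the size of the complement of [V]: a
   nonnegative function with average 0. *)
have le w : 0 <= 1 - (w \in V)%:R - A v w.
  rewrite /adj; have [wV|wV] := boolP (w \in V); first by rewrite indep // subrr subr0.
  by rewrite subr0 subr_ge0 lern1 leq_b1.
have s0 : avg (fun w => 1 - (w \in V)%:R - A v w) = 0.
  rewrite !avgB avg_cst // avg_mem cV -/(codeg1 R e v).
  by have := D1_eq v; rewrite /codeg1 => ->; rewrite subrr.
have := avg_eq0 le s0 u; rewrite /adj.
have [uV|uV] := boolP (u \in V); first by rewrite indep.
rewrite subr0; case: (e v u) => //= /eqP; rewrite subr0 oner_eq0 //.
Qed.

(** The parts [V1], containing [t], and [V2], containing [z], are disjoint: a common vertex would be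
    adjacent to [z] inside the independent set [V2]. A triangle in the remainder [V0] would form a
    5-clique with [z] and [t]. *)
Lemma two_apex x y z t : C4 x y z t != 0 -> D3 x y z = beta -> D3 x y t = beta ->
  exists V0 V1 V2 : {set T}, family_partition e beta V0 V1 V2 /\ kr_in e V0 3 = 0%N.
Proof.
move=> Q bz bt; move: (Q); rewrite C4_neq0 => /and5P[xy xz yz xt /andP[yt zt]].
have Tz : C3 x y z != 0 by rewrite C3_neq0 xy xz yz.
have Tt : C3 x y t != 0 by rewrite C3_neq0 xy xt yt.
have [c1 j1] := apex_part Tz bz; have [c2 j2] := apex_part Tt bt.
set V1 := apex x y z in c1 j1 *; set V2 := apex x y t in c2 j2 *.
have tV1 : t \in V1 by rewrite inE xt yt zt.
have zV2 : z \in V2 by rewrite inE xz yz e_sym zt.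
have dis v : v \in V1 -> v \notin V2.
  rewrite inE => /and3P[_ _ zv]; apply/negP => vV2.
  by have := j2 v z vV2; rewrite zV2 e_sym zv.
have dis2 v : v \in V2 -> v \notin V1 by apply: contraL => /dis.
have dV : [disjoint V1 & V2] by apply/pred0P => v /=; apply/negP => /andP[/dis/negP].
pose V0 := ~: (V1 :|: V2).
have cV0 : (#|V0| + #|V1| + #|V2| = #|T|)%N.
  rewrite -addnA -[in RHS](cardsC (V1 :|: V2)) addnC; congr (_ + _)%N.
  by rewrite cardsU disjoint_setI0 // cards0 subn0.
have cV0R : #|V0|%:R = n - #|V1|%:R - #|V2|%:R by rewrite -cV0 !natrD; ring.
have le_d : (#|V1| + #|V2| <= d)%N.
  move: beta_ge beta_lt => bg bl.
  rewrite -(ler_nat R) natrD c1 c2 dE -mulrDl; apply: ler_wpM2r; first exact: ler0n.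
  by lra.
have V0P v : v \in V0 -> v \notin V1 /\ v \notin V2.
  by rewrite in_setC in_setU negb_or => /andP.
have tf : kr_in e V0 3 = 0%N.
  apply/kr_in3_eq0 => // p q r /V0P[p1 p2] /V0P[q1 q2] /V0P[r1 r2] pq pr qr.
  have Q' : C4 p q r t != 0.
    by rewrite C4_neq0 pq pr qr !(e_sym _ t) !j1 // p1 q1 r1.
  have := clique5_free z Q'.
  by rewrite !(e_sym _ z) !j2 // p2 q2 r2 dis.
exists V0, V1, V2; split=> //.
split; first by rewrite disjoints_subset setCS subsetUl.
split; first by rewrite disjoints_subset setCS subsetUr.
split=> //; split; first by rewrite -setUA setUC setUCr.
split; first by rewrite cV0R c1 c2; ring.
split=> //; split=> //.
split; first by move=> u v /V0P[u1 _] v1; rewrite e_sym j1.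
split; first by move=> u v /V0P[_ u2] v2; rewrite e_sym j2.
split; first by move=> u v u1 v2; rewrite j1 // dis2.
split; first by move=> u v u1 v1; rewrite j1 // v1.
split; first by move=> u v u2 v2; rewrite j2 // v2.
exists (d - (#|V1| + #|V2|))%N; split; first by rewrite natrB // natrD c1 c2 dE; ring.
split.
  move=> u uV0; rewrite -(deg_eq u) /deg -(cardsID (V1 :|: V2) [set v | e u v]).
  rewrite (_ : [set v | e u v] :&: (V1 :|: V2) = V1 :|: V2); last first.
    apply/setIidPr/subsetP => v; rewrite in_setU => vV.
    have [u1 u2] := V0P _ uV0.
    by case/orP: vV => vV; [rewrite inE e_sym j1 | rewrite inE e_sym j2].
  rewrite cardsU disjoint_setI0 // cards0 subn0 addKn.
  by apply: eq_card => v; rewrite [in LHS]inE in_setD /V0 !in_setC !inE andbC.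
by move=> f _; rewrite tf.
Qed.
End Equality.
End Structure.

(** * Densities of the extremal family *)

(** Both directions between (ii) and (iii) pass through this form, where a triangle-free [V0]
    replaces the feasibility of [(n, beta)]. *)
Definition triangle_free_family (R : realFieldType) (beta : R) (T : finType) (e : rel T) : Prop :=
  exists V0 V1 V2 : {set T}, family_partition e beta V0 V1 V2 /\ kr_in e V0 3 = 0%N.

Section EqualityCase.
Variables (R : realFieldType) (T : finType) (e : rel T) (beta : R) (d : nat).
Hypotheses (e_sym : symmetric e) (e_irr : irreflexive e) (T_gt0 : (0 < #|T|)%N).
Hypotheses (beta_ge : 1/4 <= beta) (beta_lt : beta < 1/3).
Hypotheses (dE : d%:R = (1 - beta) * #|T|%:R) (deg_ge : forall x, (d <= deg e x)%N).

Theorem density34_equality_family : 4*(1-3*beta)*beta*density3 R e = 2*(1-2*beta)*density4 R e ->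
  triangle_free_family beta e /\ forall x, deg e x = d.
Proof.
move: beta_ge beta_lt => bg bl eq.
have [val sum] := density34_equality e_sym T_gt0 beta_ge beta_lt (D1_ge T_gt0 dE deg_ge) eq.
split; last exact: deg_eq T_gt0 beta_ge beta_lt dE deg_ge sum.
have [x0 _] := card_gt0P T_gt0.
have [y [z [t Q]]] := clique4_through T_gt0 beta_ge beta_lt dE deg_ge x0.
have two := two_apex e_sym e_irr T_gt0 beta_ge beta_lt dE deg_ge sum.
move: x0 Q => x Q.
have := Q; rewrite C4_neq0 => /and5P[xy xz yz xt /andP[yt zt]].
have tri u v w : e u v -> e u w -> e v w -> clique3 R e u v w != 0 by rewrite C3_neq0 => -> -> ->.
have P a b c f : e a b -> e a c -> e b c -> e a f -> e b f -> e c f ->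
    codeg3 R e a b c = beta -> codeg3 R e a b f = beta -> triangle_free_family beta e.
  by move=> *; apply: (two a b c f) => //; rewrite C4_neq0; apply/and5P; split => //; apply/andP.
(* If [j] of the four codegrees equal [beta] and the others [1 - 3 beta], the sum gives
   [(j - 2)(4 beta - 1) = 0]. Either two of them are [beta], or [beta = 1/4] and the two values
   coincide; [lra] closes the latter cases. *)
have s := sum _ _ _ _ Q.
have [v1|v1] := val _ _ _ (tri _ _ _ xy xz yz); last first.
  have [v2|v2] := val _ _ _ (tri _ _ _ xy xt yt); last exact: (P x y z t).
  have [v3|v3] := val _ _ _ (tri _ _ _ xz xt zt); last first.
    by apply: (P x z y t) => //; rewrite 1?e_sym // D3C23.
  have [v4|v4] := val _ _ _ (tri _ _ _ yz yt zt); last first.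
    by apply: (P y z x t) => //; rewrite 1?e_sym // D3C23 D3C12.
  by apply: (P x y z t) => //; lra.
have [v2|v2] := val _ _ _ (tri _ _ _ xy xt yt); last first.
  have [v3|v3] := val _ _ _ (tri _ _ _ xz xt zt); last first.
    by apply: (P x t y z) => //; rewrite 1?e_sym // D3C23.
  have [v4|v4] := val _ _ _ (tri _ _ _ yz yt zt); last first.
    by apply: (P y t x z) => //; rewrite 1?e_sym // ?[codeg3 _ _ y t z]D3C23 // D3C23 D3C12.
  by apply: (P x y z t) => //; lra.
have [v3|v3] := val _ _ _ (tri _ _ _ xz xt zt); last first.
  have [v4|v4] := val _ _ _ (tri _ _ _ yz yt zt); last first.
    by apply: (P z t x y) => //; rewrite 1?e_sym // ?[codeg3 _ _ z t x]D3C23 ?[codeg3 _ _ z t y]D3C23 D3C12.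
  by apply: (P x y z t) => //; lra.
have [v4|v4] := val _ _ _ (tri _ _ _ yz yt zt); by apply: (P x y z t) => //; lra.
Qed.
End EqualityCase.

Section FamilyDensities.
Variables (R : realFieldType) (T : finType) (e : rel T) (beta : R) (V0 V1 V2 : {set T}).
Hypotheses (e_sym : symmetric e) (e_irr : irreflexive e) (T_gt0 : (0 < #|T|)%N).
Hypotheses (fam : family_partition e beta V0 V1 V2) (tf : kr_in e V0 3 = 0%N).

Local Notation A := (adj R e).
Local Notation D1 := (codeg1 R e).
Local Notation D2 := (codeg2 R e).
Local Notation D3 := (codeg3 R e).
Local Notation C3 := (clique3 R e).
Local Notation chi V x := ((x \in V)%:R : R).

Definition indep_part (V : {set T}) : Prop :=
  avg (fun x => chi V x) = beta /\ forall x y, x \in V -> e x y = (y \notin V).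

Lemma trichotomy x : [|| x \in V0, x \in V1 | x \in V2].
Proof.
case: fam => _ [_ [_ [U _]]].
have : x \in V0 :|: V1 :|: V2 by rewrite U inE.
by rewrite !inE -orbA.
Qed.

Lemma n_neq0 : #|T|%:R != 0 :> R. Proof. by rewrite pnatr_eq0 -lt0n. Qed.

Lemma V1_part : indep_part V1.
Proof.
case: fam => /pred0P d01 [_ [/pred0P d12 [_ [_ [c1 [_ [j01 [_ [j12 [i1 _]]]]]]]]]].
split; first by rewrite avg_mem c1 mulfK // n_neq0.
move=> x y x1; have [y1|y1] := boolP (y \in V1); first exact/negbTE/i1.
case/or3P: (trichotomy y) => yV; last by rewrite j12.
  by rewrite e_sym j01.
by rewrite yV in y1.
Qed.

Lemma V2_part : indep_part V2.
Proof.
case: fam => _ [/pred0P d02 [/pred0P d12 [_ [_ [_ [c2 [_ [j02 [j12 [_ [i2 _]]]]]]]]]]].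
split; first by rewrite avg_mem c2 mulfK // n_neq0.
move=> x y x2; have [y2|y2] := boolP (y \in V2); first exact/negbTE/i2.
case/or3P: (trichotomy y) => yV; first by rewrite e_sym j02.
  by rewrite e_sym j12.
by rewrite yV in y2.
Qed.

Lemma V0P x : (x \in V0) = (x \notin V1) && (x \notin V2).
Proof.
case: fam => /pred0P d01 [/pred0P d02 _].
have := d01 x; have := d02 x; have := trichotomy x => /=.
by case: (x \in V0); case: (x \in V1); case: (x \in V2).
Qed.

Lemma V12_disjoint x : ~~ ((x \in V1) && (x \in V2)).
Proof. by case: fam => _ [_ [/pred0P/(_ x)/negbT]]. Qed.

Lemma part_cases x : x \notin V0 -> exists V : {set T}, x \in V /\ indep_part V.
Proof.
have := trichotomy x; case: (x \in V0) => //= /orP[x1|x2] _.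
  by exists V1; split; last exact: V1_part.
by exists V2; split; last exact: V2_part.
Qed.

Lemma chi0E x : chi V0 x = 1 - chi V1 x - chi V2 x.
Proof.
rewrite V0P; have := V12_disjoint x.
by case: (x \in V1); case: (x \in V2) => // _; rewrite /= ?subrr ?subr0 ?sub0r ?subrr.
Qed.

Lemma avg_chi0 : avg (fun x => chi V0 x) = 1 - 2*beta.
Proof.
rewrite (eq_avg (g := fun x => 1 - chi V1 x - chi V2 x)); last exact: chi0E.
by rewrite !avgB avg_cst // (proj1 V1_part) (proj1 V2_part); ring.
Qed.

Lemma avg_A_chi0 x : x \in V0 -> avg (fun y => A x y * chi V0 y) = 1 - 3*beta.
Proof.
case: fam => _ [_ [_ [_ [_ [_ [_ [_ [_ [_ [_ [_ [c [cE [reg _]]]]]]]]]]]]]] x0.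
rewrite -[RHS](mulfK n_neq0) -cE -(reg x x0) -avg_mem; apply: eq_avg => y.
by rewrite /deg_in inE /adj; case: (y \in V0); case: (e x y); rewrite ?mulr0 ?mulr1.
Qed.

Lemma A_V0 x y : x \in V0 -> A x y = A x y * chi V0 y + chi V1 y + chi V2 y.
Proof.
move=> x0; move: (x0); rewrite V0P => /andP[x1 x2].
rewrite V0P /adj; have := V12_disjoint y.
have [y1|y1] := boolP (y \in V1).
  by rewrite e_sym (proj2 V1_part) // x1 /= => /negbTE->; rewrite mulr0 add0r addr0.
have [y2|y2] := boolP (y \in V2).
  by rewrite e_sym (proj2 V2_part) // x2 /= mulr0 !add0r.
by rewrite /= mulr1 !addr0.
Qed.

Lemma D1_family x : D1 x = 1 - beta.
Proof.
rewrite /codeg1; have [x0|/part_cases[V [xV [cV jV]]]] := boolP (x \in V0).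
  rewrite (eq_avg (fun y => A_V0 y x0)) !avgD avg_A_chi0 // (proj1 V1_part) (proj1 V2_part).
  by ring.
rewrite -cV -{1}[1](@avg_cst R T T_gt0) -avgB; apply: eq_avg => y.
by rewrite /adj jV //; case: (y \in V); rewrite /= ?subrr ?subr0.
Qed.

Lemma part_E (V : {set T}) (f : T -> R) : indep_part V ->
  (forall u, u \in V -> f u = 1) -> avg (fun u => (u \notin V)%:R * f u) = avg f - beta.
Proof.
move=> [cV _] f1; rewrite -cV -avgB; apply: eq_avg => u.
have [uV|uV] := boolP (u \in V); first by rewrite /= mul0r f1 // subrr.
by rewrite /= mul1r subr0.
Qed.

Lemma D2_part V x y : indep_part V -> x \in V -> e x y -> D2 x y = 1 - 2*beta.
Proof.
move=> pV xV xy; have [cV jV] := pV.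
have yV : y \notin V by rewrite -(jV x).
rewrite /codeg2 (eq_avg (g := fun u => (u \notin V)%:R * A y u)); last by move=> u; rewrite /adj jV.
rewrite part_E // => [|u uV]; last by rewrite /adj e_sym jV // yV.
by have := D1_family y; rewrite /codeg1 => ->; ring.
Qed.

(** Stated through the indicator of [V0], so that the densities reduce to [avg2_chi0], the density
    of edges inside [V0]. *)
Lemma D2_family x y : e x y -> D2 x y = 1 - 2*beta + (4*beta-1) * (chi V0 x * chi V0 y).
Proof.
move=> xy.
have [x0|/part_cases[V [xV pV]]] := boolP (x \in V0); last first.
  by rewrite (D2_part pV xV xy) mul0r mulr0 addr0.
have [y0|/part_cases[V [yV pV]]] := boolP (y \in V0); last first.
  by rewrite D2C (D2_part pV yV) 1?e_sym // !mulr0 addr0.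
rewrite /codeg2 (eq_avg (g := fun u => chi V1 u + chi V2 u)).
  by rewrite avgD (proj1 V1_part) (proj1 V2_part) /=; ring.
move=> u; rewrite (A_V0 u x0) (A_V0 u y0) V0P.
have := V12_disjoint u.
have [u1|u1] := boolP (u \in V1); first by case: (u \in V2) => //= _; ring.
have [u2|u2] := boolP (u \in V2); first by move=> _ /=; ring.
move=> _ /=; rewrite !mulr1 !addr0 /adj.
case xu: (e x u); last by rewrite mul0r.
case yu: (e y u); last by rewrite mulr0.
have u0 : u \in V0 by rewrite V0P u1.
by have := (proj1 (kr_in3_eq0 V0 e_sym e_irr)) tf x y u x0 y0 u0 xy xu yu.
Qed.

Lemma D3_part V x y z : indep_part V -> x \in V -> e x y -> e x z ->
  D3 x y z = D2 y z - beta.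
Proof.
move=> pV xV xy xz; have [cV jV] := pV.
have yV : y \notin V by rewrite -(jV x).
have zV : z \notin V by rewrite -(jV x).
rewrite /codeg3 (eq_avg (g := fun u => (u \notin V)%:R * (A y u * A z u))); last first.
  by move=> u; rewrite /adj jV // mulrA.
by rewrite part_E // => u uV; rewrite /adj (e_sym y) (e_sym z) !jV // yV zV mulr1.
Qed.

Lemma D3_family x y z : e x y -> e x z -> e y z ->
  D3 x y z = 1 - 3*beta +
    (4*beta-1) * (chi V0 x * chi V0 y + chi V0 x * chi V0 z + chi V0 y * chi V0 z).
Proof.
move=> xy xz yz.
have [x0|x0] := boolP (x \in V0); last first.
  have [V [xV pV]] := part_cases x0.
  by rewrite (D3_part pV xV xy xz) D2_family //=; ring.
have [y0|y0] := boolP (y \in V0); last first.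
  have [V [yV pV]] := part_cases y0.
  by rewrite D3C12 (D3_part pV yV _ yz) 1?e_sym // D2_family // x0 /=; ring.
have [z0|z0] := boolP (z \in V0); last first.
  have [V [zV pV]] := part_cases z0.
  by rewrite D3C23 D3C12 (D3_part pV zV) 1?e_sym // D2_family // x0 y0 /=; ring.
by have := (proj1 (kr_in3_eq0 V0 e_sym e_irr)) tf x y z x0 y0 z0 xy xz yz.
Qed.

Lemma density2_family : density2 R e = 1 - beta.
Proof.
rewrite /density2 /avg2 avg_pair (eq_avg (g := fun _ => 1 - beta)) ?avg_cst //.
by move=> x; exact: D1_family.
Qed.

Lemma avg2_chi0 : avg2 (fun x y => A x y * (chi V0 x * chi V0 y)) = (1-2*beta)*(1-3*beta).
Proof.
rewrite /avg2 avg_pair (eq_avg (g := fun x => (1-3*beta) * chi V0 x)).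
  by rewrite avgZ avg_chi0 mulrC.
move=> x /=; have [x0|x0] := boolP (x \in V0).
  by rewrite mulr1 -(avg_A_chi0 x0); apply: eq_avg => y; rewrite mul1r.
rewrite mulr0 (eq_avg (g := fun _ => 0)) ?avg_cst // => y.
by rewrite mul0r mulr0.
Qed.

Lemma density3_family : density3 R e = 6*(1-2*beta)^+2*beta.
Proof.
rewrite density3E /avg2 (eq_avg (g := fun p => (1-2*beta)*A p.1 p.2 + (4*beta-1)*(A p.1 p.2 * (chi V0 p.1 * chi V0 p.2)))).
  by rewrite avgD !avgZ -/(avg2 A) -/(density2 R e) density2_family -/(avg2 (fun x y => A x y * (chi V0 x * chi V0 y))) avg2_chi0; ring.
case=> x y /=; have [->|] := eqVneq (A x y) 0; first by rewrite !mul0r !mulr0 addr0.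
by rewrite A_neq0 => xy; rewrite D2_family //; ring.
Qed.

Lemma density4_family : density4 R e = 12*(1-2*beta)*(1-3*beta)*beta^+2.
Proof.
pose f x y := chi V0 x * chi V0 y.
have [h1 h2] := avg3_sym e_sym f.
rewrite density4E (_ : avg3 _ = (1-3*beta)*density3 R e + (4*beta-1)*(avg3 (fun x y z => C3 x y z * f x y)
  + avg3 (fun x y z => C3 x y z * f x z) + avg3 (fun x y z => C3 x y z * f y z))); last first.
  rewrite /density3 /avg3 -!avgD -!avgZ -avgD; apply: eq_avg => -[[x y] z] /=.
  have [->|] := eqVneq (C3 x y z) 0; first by rewrite !mul0r; ring.
  by rewrite C3_neq0 => /and3P[xy xz yz]; rewrite D3_family // /f; ring.
rewrite h1 h2 avg3_edge density3_family.
rewrite (_ : avg2 _ = 2*beta*((1-2*beta)*(1-3*beta))); first by ring.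
rewrite -avg2_chi0 /avg2 -avgZ; apply: eq_avg => -[x y] /=; rewrite /f.
have [->|] := eqVneq (A x y) 0; first by rewrite !mul0r mulr0.
rewrite A_neq0 => xy; rewrite D2_family //.
by case: (x \in V0); case: (y \in V0) => /=; ring.
Qed.
End FamilyDensities.

(** * Feasibility and the main theorem *)

Lemma family_partition_preim (R : realFieldType) (beta : R) (T1 T2 : finType)
    (h : T1 -> T2) (e1 : rel T1) (e2 : rel T2) (V0 V1 V2 : {set T2}) :
  bijective h -> (forall x y, e1 x y = e2 (h x) (h y)) ->
  family_partition e2 beta V0 V1 V2 ->
  family_partition e1 beta (h @^-1: V0) (h @^-1: V1) (h @^-1: V2) /\
  kr_in e1 (h @^-1: V0) 3 = kr_in e2 V0 3.
Proof.
move=> hb eh; have h_inj := bij_inj hb; have [g gK hK] := hb.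
have him (V : {set T2}) : h @: (h @^-1: V) = V.
  apply/setP => y; apply/imsetP/idP => [[x + ->]|yV]; first by rewrite inE.
  by exists (g y); rewrite ?inE hK.
have hcard (V : {set T2}) : #|h @^-1: V| = #|V| by rewrite -(card_imset _ h_inj) him.
have cT : #|T1| = #|T2| by exact: bij_eq_card hb.
have krE : kr_in e1 (h @^-1: V0) 3 = kr_in e2 V0 3.
  by rewrite -(kr_in_imset h_inj eh) him.
case=> d01 [d02 [d12 [U [c0 [c1 [c2 [j01 [j02 [j12 [i1 [i2 [c [cE [reg min]]]]]]]]]]]]]].
have dis (X Y : {set T2}) : [disjoint X & Y] -> [disjoint h @^-1: X & h @^-1: Y].
  by move=> /pred0P d; apply/pred0P => x; rewrite /= !inE; exact: d.
split; last exact: krE.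
split; [exact: dis | split; [exact: dis | split; [exact: dis |]]].
split; first by rewrite -!preimsetU U; apply/setP => x; rewrite !inE.
rewrite !hcard cT; do 3!split=> //.
split; first by move=> x y; rewrite !inE eh; exact: j01.
split; first by move=> x y; rewrite !inE eh; exact: j02.
split; first by move=> x y; rewrite !inE eh; exact: j12.
split; first by move=> x y; rewrite !inE eh; exact: i1.
split; first by move=> x y; rewrite !inE eh; exact: i2.
exists c; split=> //; split.
  by move=> x; rewrite inE => xV; rewrite -(deg_in_imset h_inj eh) him reg.
by rewrite krE.
Qed.

Lemma induced_on_ordinals (T : finType) (e : rel T) (V : {set T}) (c m : nat) :
  simple_graph e -> (forall x, x \in V -> deg_in e V x = c) -> m = #|V| ->
  exists f : rel 'I_m, regular_graph c f /\ kr f 3 = kr_in e V 3.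
Proof.
move=> [e_sym e_irr] reg ->.
pose h (i : 'I_#|V|) := enum_val i.
have h_inj : injective h by exact: enum_val_inj.
have him : h @: setT = V.
  apply/setP => x; apply/imsetP/idP => [[i _ ->]|xV]; first exact: enum_valP.
  by exists (enum_rank_in xV x); rewrite ?inE // /h enum_rankK_in.
exists (fun i j => e (h i) (h j)); split; last by rewrite /kr -(kr_in_imset h_inj (e2 := e)) // him.
split; first by split => [i j|i]; [exact: e_sym | exact: e_irr].
by move=> i; rewrite -deg_inT -(deg_in_imset h_inj (e2 := e)) // him reg // enum_valP.
Qed.

Lemma triangle_free_family_feasible (R : realFieldType) (beta : R) (T : finType) (e : rel T) (d : nat) :
  simple_graph e -> (0 < #|T|)%N -> beta < 1 -> d%:R = (1 - beta) * #|T|%:R ->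
  triangle_free_family beta e ->
  feasible #|T| beta /\ in_family e beta.
Proof.
move=> se T0 bl dE [V0 [V1 [V2 [fam tf]]]]; have [e_sym e_irr] := se.
have n0 : 0 < #|T|%:R :> R by rewrite ltr0n.
have def : family_defined #|T| beta.
  split=> //; exists d; split=> //; split.
    by rewrite -(ltr_nat R) dE; apply: mulr_gt0; rewrite ?subr_gt0.
  (* The handshake identity excludes that [n] and [d] are both odd. *)
  have hs : (#|T| * d = 2 * kr e 2)%N.
    apply/eqP; rewrite -(eqr_nat R) !natrM -(kr_density2 e_sym e_irr R T0).
    by rewrite (density2_family e_sym T0 fam) dE; apply/eqP; ring.
  by rewrite -oddM hs oddM.
split; last by split=> //; exists V0, V1, V2.
split=> // e' W0 W1 W2 se' fam'.
have [_ [_ [_ [_ [c0 [_ [_ [_ [_ [_ [_ [_ [c [cE [reg _]]]]]]]]]]]]]]] := fam.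
have [_ [_ [_ [_ [c0' [_ [_ [_ [_ [_ [_ [_ [c' [cE' [_ min]]]]]]]]]]]]]]] := fam'.
rewrite card_ord in c0' cE'.
have cc : c' = c by apply/eqP; rewrite -(eqr_nat R) cE cE'.
have WV : #|W0| = #|V0| by apply/eqP; rewrite -(eqr_nat R) c0 c0'.
(* The triangle-free graph induced on [V0] competes in the minimality clause of every other member
   of the family. *)
have [f [freg f3]] := induced_on_ordinals se reg WV.
by apply/eqP; rewrite -leqn0; have := min f; rewrite cc f3 tf; apply.
Qed.

Lemma feasible_triangle_free (R : realFieldType) (beta : R) (T : finType) (e : rel T) :
  simple_graph e -> feasible #|T| beta -> in_family e beta -> triangle_free_family beta e.
Proof.
move=> [e_sym e_irr] [_ feas] [_ [V0 [V1 [V2 fam]]]].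
pose h (i : 'I_#|T|) : T := enum_val i.
have hb : bijective h by exists enum_rank; [exact: enum_valK | exact: enum_rankK].
have [fam' kE] := family_partition_preim (e1 := fun i j => e (h i) (h j)) hb (fun _ _ => erefl) fam.
exists V0, V1, V2; split=> //; rewrite -kE; apply: feas fam'.
by split => [i j|i]; [exact: e_sym | exact: e_irr].
Qed.

Section Main.
Variables (R : realFieldType) (T : finType) (e : rel T) (beta : R).
Hypotheses (e_sym : symmetric e) (e_irr : irreflexive e) (T_gt0 : (0 < #|T|)%N).
Hypotheses (beta_ge : 1/4 <= beta) (beta_lt : beta < 1/3).

Let n0 : #|T|%:R != 0 :> R.
Proof. by rewrite pnatr_eq0 -lt0n. Qed.
Let w0 : 1 - 2*beta != 0.
Proof. by move: beta_ge beta_lt => bg bl; apply: lt0r_neq0; lra. Qed.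
Let a0 : 1 - 3*beta != 0.
Proof. by move: beta_ge beta_lt => bg bl; apply: lt0r_neq0; lra. Qed.
Let b0 : beta != 0.
Proof. by move: beta_ge beta_lt => bg bl; apply: lt0r_neq0; lra. Qed.
Let o0 : 1 - beta != 0.
Proof. by move: beta_ge beta_lt => bg bl; apply: lt0r_neq0; lra. Qed.

Lemma normk2 : normk e 2 beta = density2 R e / (1 - beta).
Proof.
rewrite /normk /gfun; have := kr_density2 e_sym e_irr R T_gt0.
move=> h; have -> : (kr e 2)%:R = #|T|%:R ^+ 2 * density2 R e / 2 by rewrite h; field.
by field; rewrite o0 n0.
Qed.

Lemma normk3 : normk e 3 beta = density3 R e / (6 * (1-2*beta)^+2 * beta).
Proof.
rewrite /normk /gfun; have := kr_density3 e_sym e_irr R T_gt0.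
move=> h; have -> : (kr e 3)%:R = #|T|%:R ^+ 3 * density3 R e / 6 by rewrite h; field.
by field; rewrite w0 n0 b0.
Qed.

Lemma normk4 : normk e 4 beta = density4 R e / (12 * (1-2*beta) * (1-3*beta) * beta^+2).
Proof.
rewrite /normk /gfun; have := kr_density4 e_sym e_irr R T_gt0.
move=> h; have -> : (kr e 4)%:R = #|T|%:R ^+ 4 * density4 R e / 24 by rewrite h; field.
by field; rewrite w0 n0 b0 a0.
Qed.

Lemma normk23 : normk e 3 beta - normk e 2 beta =
  ((1-beta) * density3 R e - 6*beta*(1-2*beta)^+2*density2 R e) / (6 * (1-2*beta)^+2 * beta * (1-beta)).
Proof. by rewrite normk2 normk3; field; rewrite w0 b0 o0. Qed.

Lemma normk34 : normk e 4 beta - normk e 3 beta =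
  (2*(1-2*beta)*density4 R e - 4*(1-3*beta)*beta*density3 R e) /
    (24 * (1-2*beta)^+2 * (1-3*beta) * beta^+2).
Proof. by rewrite normk3 normk4; field; rewrite w0 b0 a0. Qed.

Lemma normk_family : triangle_free_family beta e ->
  [/\ normk e 2 beta = 1, normk e 3 beta = 1 & normk e 4 beta = 1].
Proof.
move=> [V0 [V1 [V2 [fam tf]]]].
rewrite normk2 normk3 normk4 (density2_family e_sym T_gt0 fam) (density3_family e_sym e_irr T_gt0 fam tf).
rewrite (density4_family e_sym e_irr T_gt0 fam tf); split.
- by rewrite divff.
- by field; rewrite w0 b0.
- by field; rewrite w0 b0 a0.
Qed.

Variable d : nat.
Hypotheses (dE : d%:R = (1 - beta) * #|T|%:R) (deg_ge : forall x, (d <= deg e x)%N).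

Lemma normk_le23 : normk e 2 beta <= normk e 3 beta.
Proof.
move: beta_ge beta_lt => bg bl; rewrite -subr_ge0 normk23; apply: divr_ge0.
  by rewrite subr_ge0; exact: density3_ge_density2 e_sym T_gt0 bg bl (D1_ge T_gt0 dE deg_ge).
by rewrite !mulr_ge0 ?exprn_ge0 //; lra.
Qed.

Lemma normk_le34 : normk e 3 beta <= normk e 4 beta.
Proof.
move: beta_ge beta_lt => bg bl; rewrite -subr_ge0 normk34; apply: divr_ge0.
  by rewrite subr_ge0; exact: density4_ge_density3 e_sym T_gt0 bg bl (D1_ge T_gt0 dE deg_ge).
by rewrite !mulr_ge0 ?exprn_ge0 //; lra.
Qed.

Lemma normk_eq34_family : normk e 4 beta = normk e 3 beta -> triangle_free_family beta e.
Proof.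
move: beta_ge beta_lt => bg bl /eqP; rewrite -subr_eq0 normk34 mulf_eq0 invr_eq0.
have /negbTE-> : 24 * (1-2*beta)^+2 * (1-3*beta) * beta^+2 != 0.
  by rewrite !mulf_neq0 ?expf_neq0 // pnatr_eq0.
rewrite orbF subr_eq0; move=> /eqP eq; have [] := density34_equality_family e_sym e_irr T_gt0 bg bl dE deg_ge _ => //.
Qed.

Lemma normk_eq23_eq34 : normk e 3 beta = normk e 2 beta -> normk e 4 beta = normk e 3 beta.
Proof.
move: beta_ge beta_lt => bg bl /eqP; rewrite -subr_eq0 normk23 mulf_eq0 invr_eq0.
have /negbTE-> : 6 * (1-2*beta)^+2 * beta * (1-beta) != 0.
  by rewrite !mulf_neq0 ?expf_neq0 // pnatr_eq0.
rewrite orbF subr_eq0; move=> /eqP eq; apply/eqP; rewrite -subr_eq0 normk34.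
have := density23_equality e_sym T_gt0 bg bl (D1_ge T_gt0 dE deg_ge) (esym eq).
by move=> ->; rewrite subrr mul0r.
Qed.
End Main.

Theorem mainTheorem7 (R : realFieldType) (beta : R) (T : finType) (e : rel T)
  (d : nat) :
  simple_graph e ->
  1 / 4 <= beta -> beta < 1 / 3 ->
  d%:R = (1 - beta) * #|T|%:R ->
  min_degree_is e d ->
  (forall t s : nat, (2 <= t)%N -> (t < s)%N -> (s <= 4)%N ->
     normk e t beta <= normk e s beta) /\
  ((exists t s : nat, [/\ (2 <= t)%N, (t < s)%N, (s <= 4)%N &
                         normk e s beta = normk e t beta]) <->
   (forall t s : nat, (2 <= t)%N -> (t < s)%N -> (s <= 4)%N ->
                         normk e s beta = normk e t beta)) /\
  ((forall t s : nat, (2 <= t)%N -> (t < s)%N -> (s <= 4)%N ->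
                         normk e s beta = normk e t beta) <->
   (feasible #|T| beta /\ in_family e beta)).
Proof.
move=> se bg bl dE [deg_ge [x0 _]]; have [e_sym e_irr] := se.
have T0 : (0 < #|T|)%N by apply/card_gt0P; exists x0.
have le23 := normk_le23 e_sym e_irr T0 bg bl dE deg_ge.
have le34 := normk_le34 e_sym e_irr T0 bg bl dE deg_ge.
have eq34 := normk_eq34_family e_sym e_irr T0 bg bl dE deg_ge.
have eq23 := normk_eq23_eq34 e_sym e_irr T0 bg bl dE deg_ge.
have fam1 := normk_family e_sym e_irr T0 bg bl.
have pairs (P : nat -> nat -> Prop) : P 2%N 3%N -> P 3%N 4%N -> P 2%N 4%N ->
    forall t s : nat, (2 <= t)%N -> (t < s)%N -> (s <= 4)%N -> P t s.
  move=> P23 P34 P24 [|[|[|[|t]]]] // s; case: s => [|[|[|[|[|s]]]]] //.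
have all_eq : triangle_free_family beta e ->
    forall t s : nat, (2 <= t)%N -> (t < s)%N -> (s <= 4)%N -> normk e s beta = normk e t beta.
  move=> /fam1[n2 n3 n4].
  by apply: (pairs (fun t s => normk e s beta = normk e t beta)); rewrite ?n2 ?n3 ?n4.
split; [|split; split].
- apply: (pairs (fun t s => normk e t beta <= normk e s beta)) => //.
  exact: le_trans le23 le34.
- move=> [t [s [t2 ts s4 eq]]]; apply/all_eq/eq34; move: eq.
  have := pairs (fun t s => normk e s beta = normk e t beta -> normk e 4 beta = normk e 3 beta).
  (* Equality for the pair 2, 4 squeezes the middle value, hence gives equality for 3, 4. *)
  apply => // eq; apply/eqP; rewrite eq_le le34 andbT eq.
  exact: le23.
- by move=> all; exists 2%N, 3%N; split=> //; apply: all.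
- move=> all; apply: (triangle_free_family_feasible se T0 _ dE); first by lra.
  by apply: eq34; apply: all.
- by move=> [feas fam]; apply: all_eq; exact: feasible_triangle_free.
Qed.
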